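(* Let $\alpha>-1$. The Markovian semigroup $(e^{-t\widetilde H_\alpha})_{t>0}$ is transient if and only if $\alpha>0$. Moreover, it is stochastically complete (conservative) for all $\alpha>-1$.
   Context: For $\alpha>-1$ and a complex sequence $u=(u_n)_{n\ge 0}$ (with $u_{-1}:=0$) put $$(\tau_\alpha u)_n=-\sqrt{n(n+\alpha)}\,u_{n-1}+(2n+1+\alpha)u_n-\sqrt{(n+1)(n+1+\alpha)}\,u_{n+1},\quad n\ge 0.$$ The discrete Laguerre operator $H_\alpha$ in $\ell^2(\mathbb{Z}_{\ge 0})$ is $H_\alpha u=\tau_\alpha u$ with domain $\{u\in\ell^2(\mathbb{Z}_{\ge0}) : \tau_\alpha u\in\ell^2(\mathbb{Z}_{\ge0})\}$; it is self-adjoint and nonnegative. Let $\sigma_\alpha(n):=\left(\frac{(\alpha+1)_n}{n!}\right)^{1/2}$, where $(x)_0:=1$, $(x)_n:=x(x+1)\cdots(x+n-1)$ for $n\ge1$, and let $\ell^p(\sigma_\alpha^2)$, $p\in\{1,2\}$, be the space of sequences with $\sum_n|u_n|^p\sigma_\alpha(n)^2<\infty$. The map $\mathcal{L}_\alpha:(u_n)_{n\ge0}\mapsto(\sigma_\alpha(n)u_n)_{n\ge0}$ is an isometric isomorphism of $\ell^2(\sigma_\alpha^2)$ onto $\ell^2(\mathbb{Z}_{\ge0})$, and $\widetilde H_\alpha:=\mathcal{L}_\alpha^{-1}H_\alpha\mathcal{L}_\alpha$ is a nonnegative self-adjoint operator in $\ell^2(\sigma_\alpha^2)$, acting by $(\widetilde\tau_\alpha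 u)_n=-n\,u_{n-1}+(2n+1+\alpha)u_n-(n+1+\alpha)u_{n+1}$. The semigroup $e^{-t\widetilde H_\alpha}=\mathcal{L}_\alpha^{-1}e^{-tH_\alpha}\mathcal{L}_\alpha$ is Markovian, i.e. positivity preserving and $\ell^\infty$-contractive; it acts on bounded sequences (and on nonnegative ones, with values in $[0,\infty]$) by $(e^{-t\widetilde H_\alpha}u)_n=\sum_{m\ge0}(e^{-t\widetilde H_\alpha}\delta_m)_n\,u_m$, where $\delta_m=(\delta_{m,k})_{k\ge0}$. The semigroup is transient if $\int_0^\infty(e^{-t\widetilde H_\alpha}f)_n\,dt<\infty$ for every $n\ge0$ and every nonnegative $f\in\ell^1(\sigma_\alpha^2)$. It is stochastically complete (conservative) if $e^{-t\widetilde H_\alpha}\mathbf{1}=\mathbf{1}$ for some (and hence for all) $t>0$, where $\mathbf{1}$ is the constant sequence $1$. *)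

(* Defs.v *)
From HB Require Import structures.
From mathcomp Require Import all_boot all_order all_algebra.
From mathcomp Require Import all_classical all_reals all_analysis.
From mathcomp Require Export complex.

Set Implicit Arguments.
Unset Strict Implicit.
Unset Printing Implicit Defensive.

Import Order.TTheory GRing.Theory Num.Theory.
Import numFieldNormedType.Exports.

Local Open Scope classical_set_scope.
Local Open Scope ring_scope.
Local Open Scope complex_scope.

Section EllTwo.
Variable R : realType.

Definition cabs (z : R[i]) : R := ComplexField.Normc.normc z.

(* The squared l^2 norm, with value +oo outside l^2. *)
Definition sqnorm (u : nat -> R[i]) : \bar R :=
  (\sum_(0 <= n <oo) (cabs (u n) ^+ 2)%:E)%E.

Definition ell2 : set (nat -> R[i]) := [set u | (sqnorm u < +oo)%E].

Definition delta (m : nat) : nat -> R[i] := fun k => (m == k)%:R.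

(* [T] is e^{-tA} for an operator A in l^2 with domain [D]: on l^2, [T] is a
   strongly continuous semigroup of linear contractions whose infinitesimal
   generator, domain included, is -A. For a nonnegative self-adjoint A there is
   exactly one such semigroup. The values of [T t u] for [t < 0] or [u] outside
   l^2 are irrelevant. *)
Record semigroup_exp_neg (D : set (nat -> R[i]))
    (A : (nat -> R[i]) -> (nat -> R[i]))
    (T : R -> (nat -> R[i]) -> (nat -> R[i])) : Prop := {
  semigroup_linear : forall t (a : R[i]) u v, 0 <= t -> ell2 u -> ell2 v ->
    T t (fun n => a * u n + v n) = (fun n => a * T t u n + T t v n) ;
  semigroup_contraction : forall t u, 0 <= t -> ell2 u ->
    (sqnorm (T t u) <= sqnorm u)%E ;
  semigroup_zero : forall u, ell2 u -> T 0 u = u ;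
  semigroup_add : forall s t u, 0 <= s -> 0 <= t -> ell2 u ->
    T (s + t) u = T s (T t u) ;
  semigroup_continuous : forall u, ell2 u ->
    sqnorm (fun n => T h u n - u n) @[h --> 0^'+] --> 0%E ;
  semigroup_generator : forall u v, ell2 u -> ell2 v ->
    (sqnorm (fun n => (h^-1)%:C * (T h u n - u n) - v n) @[h --> 0^'+] --> 0%E
     <-> D u /\ v = (fun n => - A u n))
}.

End EllTwo.

Section Laguerre.
Variables (R : realType) (alpha : R).

Definition tau (u : nat -> R[i]) (n : nat) : R[i] :=
  - (Num.sqrt (n%:R * (n%:R + alpha)))%:C * (if n is m.+1 then u m else 0)
  + (2 * n%:R + 1 + alpha)%:C * u n
  - (Num.sqrt ((n%:R + 1) * (n%:R + 1 + alpha)))%:C * u n.+1.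

Definition laguerre_dom : set (nat -> R[i]) :=
  [set u | ell2 u /\ ell2 (tau u)].

Definition rising (x : R) (n : nat) : R := \prod_(i < n) (x + i%:R).

Definition sigma (n : nat) : R := Num.sqrt (rising (alpha + 1) n / n`!%:R).

Definition Lmap (u : nat -> R[i]) : nat -> R[i] := fun n => (sigma n)%:C * u n.
Definition Lmap_inv (u : nat -> R[i]) : nat -> R[i] :=
  fun n => ((sigma n)^-1)%:C * u n.

(* In the rest of the section [T t] stands for e^{-tH}, H the discrete Laguerre
   operator. *)
Variable T : R -> (nat -> R[i]) -> (nat -> R[i]).

Definition tilde (t : R) (u : nat -> R[i]) : nat -> R[i] :=
  Lmap_inv (T t (Lmap u)).

(* Action on nonnegative sequences, with values in [0, +oo]. As [tilde t] is
   positivity preserving, the kernel is real and nonnegative, so that [Re] is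
   only a cast from R[i] to R. *)
Definition tilde_nonneg (t : R) (f : nat -> R) (n : nat) : \bar R :=
  (\sum_(0 <= m <oo) (complex.Re (tilde t (@delta R m) n) * f m)%:E)%E.

(* [w] is the image of the bounded sequence [u]. *)
Definition tilde_bounded (t : R) (u w : nat -> R[i]) : Prop :=
  forall n, cabs (\sum_(0 <= m < N) tilde t (@delta R m) n * u m - w n)
              @[N --> \oo] --> (0 : R).

Definition ell1_sigma2 : set (nat -> R) :=
  [set f | (\sum_(0 <= n <oo) (`|f n| * sigma n ^+ 2)%:E < +oo)%E].

Definition transient : Prop :=
  forall (f : nat -> R), (forall n, 0 <= f n) -> ell1_sigma2 f ->
  forall n, (\int[@lebesgue_measure R]_(t in `[0%R, +oo[) tilde_nonneg t f n
             < +oo)%E.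

(* Requiring this for some t > 0 or for all t > 0 is the same, by the semigroup
   property and positivity. *)
Definition stochastically_complete : Prop :=
  forall t, 0 < t -> tilde_bounded t (fun=> 1) (fun=> 1).

End Laguerre.

(* Main.v *)
Require Import Defs.
From mathcomp Require Import all_boot all_order all_algebra.
From mathcomp Require Import all_classical all_reals all_analysis.
From mathcomp Require Import ring lra.
Set Implicit Arguments.
Unset Strict Implicit.
Unset Printing Implicit Defensive.
Import Order.TTheory GRing.Theory Num.Theory.
Import numFieldNormedType.Exports.
Local Open Scope classical_set_scope.
Local Open Scope ring_scope.

(** The heat flow of the discrete Laguerre operator is explicit on geometric
    sequences. In the variable r = 1 / (1 - q), the curve
      r |-> geom r = (n |-> r ^ (- (1 + alpha)) (1 - 1 / r) ^ n)
    satisfies d/dr geom r = - ltau (geom r), where ltau is the operator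
    conjugated by sigma. Uniqueness for the Cauchy problem
    ([semigroup_solution]) then gives that e^(-tH) sends sigma * geom r to
    sigma * geom (r + t), for r >= 1 ([semigroup_lgeom]).

    For r = 1 the sequence is delta_0, so column 0 of the heat kernel
    K_t(n, m) = (e^(-t H~) delta_m)_n is known: K_t(n, 0) = geom (1 + t) n. All
    delta_m lie in the domain, so each row of the kernel satisfies an equation
    of first order in t and second order in m ([hkernel_part_ladder]), in which
    column 0 determines all the others ([ladder_eq0]). Three consequences
    follow by checking column 0 only: the kernel is real; row 0 is
    K_t(0, m) = sigma(m) ^ 2 geom (1 + t) m; and consecutive rows satisfy a
    recurrence with nonnegative coefficients for t <= 1
    ([hkernel_recurrence]). Hence K is nonnegative for t <= 1, and for all t by
    the Chapman-Kolmogorov equation.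

    Completeness. Expanding sigma * geom r over the delta_m gives
      sum_m K_t(n, m) geom r m = geom (r + t) n;
    dividing by r ^ (- (1 + alpha)) and letting r tend to infinity gives
    sum_m K_t(n, m) = 1 ([cvg_sum_hkernel]).

    Transience. Since K_t(0, 0) = (1 + t) ^ (- (1 + alpha)) is not integrable
    for alpha <= 0, transience forces alpha > 0. Conversely
      K_1(0, n) K_t(n, m) <= K_(1+t)(0, m)
                          <= sigma(m) ^ 2 (1 + t) ^ (- (1 + alpha)),
    which is integrable in t when alpha > 0 and summable against every f in
    l^1(sigma ^ 2). *)

(** * Elementary real inequalities *)

Section Elementary.
Variable R : realType.
Implicit Types (x a b c r : R) (k : nat).

Lemma bernoulli_ineq k x : -1 <= x -> 1 + k%:R * x <= (1 + x) ^+ k.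
Proof.
move=> x1; elim: k => [|k IH]; first by rewrite mul0r addr0 expr0.
rewrite exprS; apply: (@le_trans _ _ ((1 + x) * (1 + k%:R * x))).
  by rewrite -natr1; have := ler0n R k; have := sqr_ge0 x; nra.
by rewrite ler_wpM2l//; lra.
Qed.

Lemma bernoulli_sub k x : 0 <= x <= 1 -> 1 - k%:R * x <= (1 - x) ^+ k.
Proof. by move=> /andP[x0 x1]; rewrite -mulrN bernoulli_ineq// lerN2. Qed.

(** A polynomial weight costs only part of the geometric decay: if y is so
    close to 1 that x <= y ^ k.+1, then k of the factors y ^ n absorb
    (n + 1) ^ k, because (n + 1) y ^ n is at most the sum of the first n + 1
    powers of y, and the last factor is summable. *)
Lemma sum_poly_geo_le k (x : R) : 0 <= x < 1 -> exists M, forall N,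
  \sum_(0 <= n < N) (n%:R + 1) ^+ k * x ^+ n <= M.
Proof.
move=> /andP[x0 x1].
(* Bernoulli's inequality turns this choice of d into x <= y ^ k.+1. *)
pose d := (1 - x) / k.+1%:R; pose y := 1 - d.
have k0 : 0 < k.+1%:R :> R by rewrite ltr0n.
have d0 : 0 < d by rewrite divr_gt0 ?subr_gt0.
have d1 : d <= 1.
  by rewrite ler_pdivrMr// mul1r (@le_trans _ _ 1) ?ler1n//; lra.
have y0 : 0 <= y by rewrite /y; lra.
have geo N : \sum_(0 <= n < N) y ^+ n <= d^-1.
  rewrite -[leRHS]mul1r ler_pdivlMr// mulrC.
  elim: N => [|N IH]; first by rewrite big_nil mulr0.
  suff : d * \sum_(0 <= n < N) y ^+ n = 1 - y ^+ N.
    move=> E; rewrite big_nat_recr//= mulrDr E.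
    by have := exprn_ge0 N y0; rewrite /y; nra.
  elim: N {IH} => [|N IH]; first by rewrite big_nil mulr0 expr0 subrr.
  by rewrite big_nat_recr//= mulrDr IH exprS /y; ring.
have bnd n : (n%:R + 1) * y ^+ n <= d^-1.
  apply: le_trans (geo n.+1); rewrite natr1 mulr_natl.
  rewrite -[n.+1]subn0 -sumr_const_nat big_nat [leRHS]big_nat.
  apply: ler_sum => j /andP[_ jn].
  by apply: ler_wiXn2l => //; rewrite /y; lra.
have xy : x <= y ^+ k.+1.
  apply: le_trans (bernoulli_sub _ _); last by rewrite ltW.
  by rewrite /d mulrC divfK ?gt_eqF//; lra.
exists (d^-1 ^+ k * d^-1) => N.
apply: (@le_trans _ _ (d^-1 ^+ k * \sum_(0 <= n < N) y ^+ n)); last first.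
  by rewrite ler_wpM2l// exprn_ge0// invr_ge0 ltW.
rewrite mulr_sumr; apply: ler_sum => n _.
apply: (@le_trans _ _ ((n%:R + 1) ^+ k * (y ^+ k.+1) ^+ n)).
  by rewrite ler_wpM2l ?exprn_ge0 ?addr_ge0// lerXn2r ?nnegrE ?exprn_ge0.
have -> : y ^+ k.+1 ^+ n = y ^+ n ^+ k * y ^+ n.
  by rewrite -!exprM mulSn exprD mulrC (mulnC n).
rewrite mulrA -exprMn ler_wpM2r ?exprn_ge0//.
by rewrite lerXn2r ?nnegrE ?mulr_ge0 ?addr_ge0 ?exprn_ge0 ?invr_ge0// (ltW d0).
Qed.

Lemma ler_of_inv (a b c : R) : 0 <= c ->
  (forall r, 1 <= r -> a <= b + c / r) -> a <= b.
Proof.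
move=> c0 H; apply/ler_addgt0Pr => e e0.
have q0 : 0 <= c / e by rewrite divr_ge0// ltW.
have r1 : 1 <= 1 + c / e by lra.
apply: le_trans (H _ r1) _; rewrite lerD2l ler_pdivrMr; last by lra.
by rewrite mulrDr mulrCA divff ?gt_eqF// !mulr1; lra.
Qed.

End Elementary.

(** * Square-summable sequences *)

Section SquareSummable.
Variable R : realType.
Implicit Types (u v : nat -> R[i]) (c : R) (z : R[i]).

Lemma sqr_cabs z : cabs z ^+ 2 = complex.Re z ^+ 2 + complex.Im z ^+ 2.
Proof. by case: z => a b; rewrite /cabs /= sqr_sqrtr// addr_ge0 ?sqr_ge0. Qed.

(** The real part for [false] and the imaginary part for [true], so that one
    real-valued argument treats both. *)
Definition part (b : bool) z : R := if b then complex.Im z else complex.Re z.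

Lemma partD b z1 z2 : part b (z1 + z2) = part b z1 + part b z2.
Proof. by case: b z1 z2 => -[? ?] [? ?]. Qed.

Lemma partB b z1 z2 : part b (z1 - z2) = part b z1 - part b z2.
Proof. by case: b z1 z2 => -[? ?] [? ?]. Qed.

Lemma partZ b (x : R) z : part b (x%:C%C * z) = x * part b z.
Proof.
by case: b z => -[c d]; rewrite /= mul0r ?(mulrC 0) ?addr0 ?subr0.
Qed.

Lemma sqr_part_le b z : part b z ^+ 2 <= cabs z ^+ 2.
Proof. by rewrite sqr_cabs; case: b; rewrite /= ?lerDl ?lerDr sqr_ge0. Qed.

Lemma sqr_cabsD z1 z2 :
  cabs (z1 + z2) ^+ 2 <= 2 * cabs z1 ^+ 2 + 2 * cabs z2 ^+ 2.
Proof.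
rewrite !sqr_cabs; case: z1 z2 => a b [c d] /=.
by have := sqr_ge0 (a - c); have := sqr_ge0 (b - d); nra.
Qed.

Lemma sqr_cabsM z1 z2 : cabs (z1 * z2) ^+ 2 = cabs z1 ^+ 2 * cabs z2 ^+ 2.
Proof. by rewrite /cabs ComplexField.Normc.normcM exprMn. Qed.

(** The bound [sqnorm u <= c] through finite partial sums, which keeps the
    estimates below inside the reals. *)
Definition l2le u c := forall N, \sum_(0 <= n < N) cabs (u n) ^+ 2 <= c.

Lemma sqnorm_le u c : (sqnorm u <= c%:E)%E <-> l2le u c.
Proof.
have t0 n : (0 <= (cabs (u n) ^+ 2)%:E)%E by rewrite lee_fin sqr_ge0.
split=> [uc N|uc].
  rewrite -lee_fin -sumEFin (le_trans _ uc)//.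
  exact: (@nneseries_lim_ge _ _ xpredT 0%N).
apply: lime_le; first exact: is_cvg_nneseries.
by apply: nearW => N; rewrite sumEFin lee_fin.
Qed.

Lemma ell2P u : ell2 u <-> exists c, l2le u c.
Proof.
split=> [u2|[c /sqnorm_le uc]]; last by rewrite /ell2/= (le_lt_trans uc)// ltry.
have u0 : (0 <= sqnorm u)%E.
  by apply: nneseries_ge0 => n _ _; rewrite lee_fin sqr_ge0.
exists (fine (sqnorm u)); apply/sqnorm_le; rewrite fineK//.
by rewrite ge0_fin_numE.
Qed.

Lemma l2le_ell2 u c : l2le u c -> ell2 u.
Proof. by move=> uc; apply/ell2P; exists c. Qed.

Lemma l2leW u c d : c <= d -> l2le u c -> l2le u d.
Proof. by move=> cd uc N; exact: le_trans (uc N) cd. Qed.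

Lemma l2le_cabs u c n : l2le u c -> cabs (u n) ^+ 2 <= c.
Proof.
move/(_ n.+1); apply: le_trans; rewrite big_nat_recr//= lerDr.
by apply: sumr_ge0 => ? _; exact: sqr_ge0.
Qed.

Lemma l2leD u v c d : l2le u c -> l2le v d ->
  l2le (fun n => u n + v n) (2 * c + 2 * d).
Proof.
move=> uc vd N; have := uc N; have := vd N.
move=> vN uN; apply: (@le_trans _ _ (\sum_(0 <= n < N)
   (2 * cabs (u n) ^+ 2 + 2 * cabs (v n) ^+ 2))).
  by apply: ler_sum => n _; exact: sqr_cabsD.
by rewrite big_split/= -!mulr_sumr; lra.
Qed.

Lemma l2leZ (a : R[i]) u c : l2le u c ->
  l2le (fun n => a * u n) (cabs a ^+ 2 * c).
Proof.
move=> uc N; under eq_bigr do rewrite sqr_cabsM.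
by rewrite -mulr_sumr ler_wpM2l ?sqr_ge0.
Qed.

Lemma l2leN u c : l2le u c -> l2le (fun n => - u n) c.
Proof.
by move=> uc N; under eq_bigr do rewrite /cabs normcN; exact: uc.
Qed.

Lemma l2leB u v c d : l2le u c -> l2le v d ->
  l2le (fun n => u n - v n) (2 * c + 2 * d).
Proof. by move=> uc /l2leN; exact: l2leD. Qed.

Lemma ell2D u v : ell2 u -> ell2 v -> ell2 (fun n => u n + v n).
Proof.
move=> /ell2P[c uc] /ell2P[d vd]; exact: l2le_ell2 (l2leD uc vd).
Qed.

Lemma ell2Z (a : R[i]) u : ell2 u -> ell2 (fun n => a * u n).
Proof. by move=> /ell2P[c uc]; exact: l2le_ell2 (l2leZ a uc). Qed.

Lemma ell2N u : ell2 u -> ell2 (fun n => - u n).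
Proof. by move=> /ell2P[c uc]; exact: l2le_ell2 (l2leN uc). Qed.

Lemma ell2B u v : ell2 u -> ell2 v -> ell2 (fun n => u n - v n).
Proof. by move=> u2 /ell2N; exact: ell2D. Qed.

Lemma cvg_sqnorm0 (g : R -> nat -> R[i]) :
  sqnorm (g h) @[h --> 0^'+] --> 0%E ->
  forall e, 0 < e -> \forall h \near 0^'+, l2le (g h) e.
Proof.
move=> /fine_cvgP[gfin /cvgrPdist_le g0] e e0.
near=> h; apply/sqnorm_le.
have hf : sqnorm (g h) \is a fin_num by near: h.
rewrite -(fineK hf) lee_fin.
have /= : `|0 - fine (sqnorm (g h))| <= e by near: h; exact: g0.
by rewrite sub0r normrN; apply: le_trans; exact: ler_norm.
Unshelve. all: by end_near. Qed.

End SquareSummable.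

(** * Functions with zero right derivative *)

Section RightDerivative.
Variable R : realType.

Lemma near0rP (P : R -> Prop) : (\forall h \near 0^'+, P h) <->
  exists2 d : R, 0 < d & forall h, 0 < h -> h < d -> P h.
Proof.
split=> [[d /= d0 dP]|[d d0 dP]].
  exists d => // h h0 hd; apply: dP => //=.
  by rewrite sub0r normrN gtr0_norm.
exists d => //= h; rewrite /= sub0r normrN => hd h0.
by apply: dP => //; rewrite -(gtr0_norm h0).
Qed.

(** The semigroup only provides right derivatives, so the mean value theorem
    does not apply. For e > 0 let s be the supremum of the times up to which
    |psi y - psi 0| <= e y holds: left continuity gives the bound at s itself,
    and the right derivative would extend it beyond s if s < t. *)
Lemma rderiv0_cst (psi : R -> R) (t : R) : 0 <= t ->
  (forall s, 0 <= s -> s < t -> forall e, 0 < e ->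
    \forall h \near 0^'+, `|psi (s + h) - psi s| <= e * h) ->
  (forall s, 0 < s -> s <= t -> forall e, 0 < e ->
    \forall h \near 0^'+, `|psi s - psi (s - h)| <= e) ->
  psi t = psi 0.
Proof.
move=> t0 rightd leftc.
have key e : 0 < e -> `|psi t - psi 0| <= e * t.
  move=> e0.
  pose A := [set x : R | (0 <= x <= t) /\
    forall y, 0 <= y -> y <= x -> `|psi y - psi 0| <= e * y].
  have A0 : A 0.
    split=> [|y y0 y0']; first by rewrite lexx.
    have -> : y = 0 by apply/eqP; rewrite eq_le y0'.
    by rewrite subrr normr0 mulr0.
  have supA : has_sup A.
    by split; [exists 0|exists t => x [/andP[]]].
  set s := sup A.
  have s0 : 0 <= s by exact: ub_le_sup supA.2 _ A0.
  have st : s <= t by apply: ge_sup; [exists 0|move=> x [/andP[]]].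
  have below y : 0 <= y -> y < s -> `|psi y - psi 0| <= e * y.
    move=> y0 ys; have [x [_ Ax] yx] : exists2 x, A x & y < x.
      exact: sup_gt supA.1 ys.
    by apply: Ax => //; exact: ltW.
  have at_s : `|psi s - psi 0| <= e * s.
    move: s0; rewrite le_eqVlt => /predU1P[<-|s0].
      by rewrite subrr normr0 mulr0.
    apply/ler_addgt0Pl => e' e'0.
    have /near0rP[d d0 dP] := leftc _ s0 st _ e'0.
    pose h := Num.min s d / 2.
    have hm : 0 < Num.min s d by rewrite lt_min s0.
    have h0 : 0 < h by rewrite divr_gt0.
    have [hs hd] : h < s /\ h < d.
      have : h < Num.min s d by rewrite /h; lra.
      by rewrite lt_min => /andP.
    rewrite -(subrKA (psi (s - h))) (le_trans (ler_normD _ _))// lerD ?dP//.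
    apply: (le_trans (below (s - h) _ _)); [lra|lra|].
    by rewrite ler_wpM2l// ?ltW//; lra.
  have upto y : 0 <= y -> y <= s -> `|psi y - psi 0| <= e * y.
    by move=> y0; rewrite le_eqVlt => /predU1P[->//|]; exact: below.
  move: st; rewrite le_eqVlt => /predU1P[<-//|st].
  have /near0rP[d d0 dP] := rightd _ s0 st _ e0.
  pose x := s + Num.min (t - s) d / 2.
  have hm : 0 < Num.min (t - s) d by rewrite lt_min d0 subr_gt0 st.
  have [mt md] : Num.min (t - s) d <= t - s /\ Num.min (t - s) d <= d.
    by rewrite !ge_min !lexx orbT.
  suff : A x by move=> /(ub_le_sup supA.2); rewrite -/s /x; lra.
  split=> [|y y0 yx]; first by rewrite /x; apply/andP; split; lra.
  have [ys|sy] := leP y s; first exact: upto.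
  have := dP (y - s); rewrite subr_gt0 addrCA subrr addr0 => /(_ sy) H.
  rewrite -(subrKA (psi s)) (le_trans (ler_normD _ _))//.
  have {H} : `|psi y - psi s| <= e * (y - s) by apply: H; move: yx; rewrite /x; lra.
  by move: at_s; lra.
apply/eqP; rewrite -subr_eq0 -normr_le0; apply/ler_addgt0Pl => e e0.
rewrite addr0; have t1 : 0 < t + 1 by lra.
apply: (le_trans (key (e / (t + 1)) _)); first by rewrite divr_gt0.
rewrite mulrAC ler_pdivrMr//; nra.
Qed.

End RightDerivative.

(** * Consequences of the semigroup axioms *)

Section Semigroup.
Variables (R : realType) (D : set (nat -> R[i])).
Variables (A : (nat -> R[i]) -> (nat -> R[i])).
Variables (T : R -> (nat -> R[i]) -> (nat -> R[i])).
Hypothesis hT : semigroup_exp_neg D A T.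
Implicit Types (u v : nat -> R[i]) (t s : R).

Lemma ell2_0 : ell2 (fun=> 0 : R[i]).
Proof.
apply/ell2P; exists 0 => N; rewrite big1// => n _.
by rewrite /cabs ComplexField.Normc.normc0 expr0n.
Qed.

Lemma semigroup0 t : 0 <= t -> T t (fun=> 0) = fun=> 0.
Proof.
move=> t0; have := semigroup_linear hT (-1) t0 ell2_0 ell2_0.
have -> : (fun _ : nat => -1 * 0 + 0 : R[i]) = fun=> 0.
  by apply/funext => n; rewrite mulr0 addr0.
by move=> ->; apply/funext => n; rewrite mulN1r addNr.
Qed.

Lemma semigroupZ t (a : R[i]) u : 0 <= t -> ell2 u ->
  T t (fun n => a * u n) = (fun n => a * T t u n).
Proof.
move=> t0 u2; have := semigroup_linear hT a t0 u2 ell2_0.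
under eq_fun do rewrite addr0.
by move=> ->; rewrite semigroup0//; apply/funext => n; rewrite addr0.
Qed.

Lemma semigroupD t u v : 0 <= t -> ell2 u -> ell2 v ->
  T t (fun n => u n + v n) = (fun n => T t u n + T t v n).
Proof.
move=> t0 u2 v2; have := semigroup_linear hT 1 t0 u2 v2.
under eq_fun do rewrite mul1r.
by move=> ->; apply/funext => n; rewrite mul1r.
Qed.

Lemma semigroupB t u v : 0 <= t -> ell2 u -> ell2 v ->
  T t (fun n => u n - v n) = (fun n => T t u n - T t v n).
Proof.
move=> t0 u2 v2; rewrite semigroupD//; last exact: ell2N.
apply/funext => n; congr (_ + _).
have := semigroupZ (-1) t0 v2.
by under eq_fun do rewrite mulN1r; move=> ->; rewrite mulN1r.
Qed.

Lemma semigroup_l2le t u c : 0 <= t -> l2le u c -> l2le (T t u) c.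
Proof.
move=> t0 uc; apply/sqnorm_le; have /sqnorm_le := uc; apply: le_trans.
by apply: (semigroup_contraction hT) => //; exact: l2le_ell2 uc.
Qed.

Lemma semigroup_ell2 t u : 0 <= t -> ell2 u -> ell2 (T t u).
Proof.
by move=> t0 /ell2P[c uc]; apply: l2le_ell2; exact: semigroup_l2le uc.
Qed.

Lemma semigroup_near0 u e : ell2 u -> 0 < e ->
  \forall h \near 0^'+, l2le (fun n => T h u n - u n) e.
Proof.
by move=> u2; apply: (cvg_sqnorm0 (g := fun h n => T h u n - u n)); exact: (semigroup_continuous hT).
Qed.

Lemma semigroup_deriv0 u e : D u -> ell2 u -> ell2 (A u) -> 0 < e ->
  \forall h \near 0^'+,
    l2le (fun n => T h u n - u n + h%:C%C * A u n) (e * h ^+ 2).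
Proof.
move=> Du u2 Au2 e0.
have /(semigroup_generator hT u2) : ell2 (fun n => - A u n) by exact: ell2N.
move=> [_ /(_ (conj Du erefl))].
move/(cvg_sqnorm0 (g := fun h n => (h^-1)%:C%C * (T h u n - u n) - - A u n)).
move/(_ _ e0) => He; near=> h.
have h0 : 0 < h by near: h; exact: nbhs_right_gt.
have : l2le (fun n => (h^-1)%:C%C * (T h u n - u n) - - A u n) e by near: h.
move=> /(l2leZ h%:C%C); rewrite sqr_cabs/= expr0n addr0 mulrC.
suff -> : (fun n => h%:C%C * ((h^-1)%:C%C * (T h u n - u n) - - A u n)) =
  (fun n => T h u n - u n + h%:C%C * A u n) by [].
apply/funext => n; rewrite opprK mulrDr mulrA -rmorphM/= divff ?gt_eqF//.
by rewrite mul1r.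
Unshelve. all: by end_near. Qed.

(** Apply the contraction [T t] to the derivative at 0. *)
Lemma semigroup_deriv t u e : 0 <= t -> D u -> ell2 u -> ell2 (A u) -> 0 < e ->
  \forall h \near 0^'+,
    l2le (fun n => T (t + h) u n - T t u n + h%:C%C * T t (A u) n) (e * h ^+ 2).
Proof.
move=> t0 Du u2 Au2 e0; near=> h.
have h0 : 0 <= h by apply: ltW; near: h; exact: nbhs_right_gt.
have : l2le (fun n => T h u n - u n + h%:C%C * A u n) (e * h ^+ 2).
  by near: h; exact: semigroup_deriv0.
have Th2 : ell2 (T h u) by exact: semigroup_ell2.
move=> /(semigroup_l2le t0); rewrite semigroupD//; [|exact: ell2B|exact: ell2Z].
by rewrite semigroupB// semigroupZ// -(semigroup_add hT).
Unshelve. all: by end_near. Qed.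

Lemma part_inj (z1 z2 : R[i]) : (forall b, part b z1 = part b z2) -> z1 = z2.
Proof.
by case: z1 z2 => a b [c d] H; congr Complex; [exact: (H false)|exact: (H true)].
Qed.

Lemma l2le_part u c b n : l2le u (c ^+ 2) -> 0 <= c -> `|part b (u n)| <= c.
Proof.
move=> uc c0; rewrite -(ger0_norm c0) -ler_sqr ?nnegrE// !real_normK ?num_real//.
exact: le_trans (sqr_part_le _ _) (l2le_cabs n uc).
Qed.

(** Uniqueness for the Cauchy problem: if U solves U' = - A U then
    s |-> T (t - s) (U s) has zero right derivative in norm, hence is
    coordinatewise constant, and it joins T t (U 0) to U t. *)
Lemma semigroup_solution (U : R -> nat -> R[i]) t : 0 <= t ->
  (forall s, 0 <= s -> [/\ D (U s), ell2 (U s) & ell2 (A (U s))]) ->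
  (forall s e, 0 <= s -> 0 < e -> \forall h \near 0^'+,
    l2le (fun n => U (s + h) n - U s n + h%:C%C * A (U s) n) (e * h ^+ 2)) ->
  (forall s e, 0 < s -> 0 < e -> \forall h \near 0^'+,
    l2le (fun n => U s n - U (s - h) n) e) ->
  T t (U 0) = U t.
Proof.
move=> t0 UD rightd leftc; apply/funext => n; apply: part_inj => b.
pose psi s := part b (T (t - s) (U s) n).
have U2 s : 0 <= s -> ell2 (U s) by move=> /UD[].
suff : psi t = psi 0.
  rewrite /psi subrr subr0 (semigroup_zero hT); first by move=> ->.
  exact: U2.
apply: rderiv0_cst => // [s s0 st e e0|s s0 st e e0].
  have e4 : 0 < e ^+ 2 / 4 by rewrite divr_gt0// exprn_gt0.
  have [Ds s2 As2] := UD s s0.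
  near=> h.
  have h0 : 0 < h by near: h; exact: nbhs_right_gt.
  have hts : h <= t - s.
    by near: h; apply: nbhs_right_le; rewrite subr_gt0.
  have H1 : l2le (fun n => U (s + h) n - U s n + h%:C%C * A (U s) n)
     (e ^+ 2 / 4 * h ^+ 2) by near: h; exact: rightd.
    (* The increment is T (t - s - h) applied to U (s + h) - T h (U s), whose two
     terms have the same first-order expansion at s. *)
have H2 : l2le (fun n => T h (U s) n - U s n + h%:C%C * A (U s) n)
     (e ^+ 2 / 4 * h ^+ 2) by near: h; exact: semigroup_deriv0.
  have Th2 : ell2 (T h (U s)) by apply: semigroup_ell2 => //; exact: ltW.
  have sh0 : 0 <= s + h by lra.
  have H3 : l2le (fun n => U (s + h) n - T h (U s) n) ((e * h) ^+ 2).
    have := l2leB H1 H2.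
    rewrite (_ : 2 * _ + 2 * _ = (e * h) ^+ 2); last by field.
    suff -> : (fun n => U (s + h) n - U s n + h%:C%C * A (U s) n -
      (T h (U s) n - U s n + h%:C%C * A (U s) n)) =
      (fun n => U (s + h) n - T h (U s) n) by [].
    by apply/funext => k; ring.
  have tsh : 0 <= t - (s + h) by lra.
  rewrite /psi -partB.
  have -> : t - s = (t - (s + h)) + h by ring.
  rewrite (semigroup_add hT tsh (ltW h0) s2).
  have := semigroup_l2le tsh H3; rewrite semigroupB//; last exact: U2.
  by move=> /l2le_part; apply; rewrite mulr_ge0// ltW.
have [Ds s2 As2] := UD s (ltW s0).
have e4 : 0 < e ^+ 2 / 16 by rewrite divr_gt0// exprn_gt0.
near=> h.
have h0 : 0 < h by near: h; exact: nbhs_right_gt.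
have hs : h <= s by near: h; exact: nbhs_right_le.
have H1 : l2le (fun n => U s n - U (s - h) n) (e ^+ 2 / 16).
  by near: h; exact: leftc.
have H2 : l2le (fun n => T h (U s) n - U s n) (e ^+ 2 / 16).
  by near: h; exact: semigroup_near0.
have Ush2 : ell2 (U (s - h)) by apply: U2; lra.
have H3 : l2le (fun n => U s n - T h (U (s - h)) n) (e ^+ 2).
  have := semigroup_l2le (ltW h0) H1; rewrite (semigroupB (ltW h0) s2 Ush2).
  move=> H; rewrite (_ : (fun n => _) = (fun n => T h (U s) n -
    T h (U (s - h)) n - (T h (U s) n - U s n))); last first.
    by apply/funext => k; ring.
  by apply: l2leW (l2leB H H2); have := sqr_ge0 e; lra.
have ts : 0 <= t - s by lra.
rewrite /psi -partB.
have -> : t - (s - h) = (t - s) + h by ring.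
rewrite (semigroup_add hT ts (ltW h0) Ush2).
have := semigroup_l2le ts H3; rewrite (semigroupB ts s2 (semigroup_ell2 (ltW h0) Ush2)).
by move=> /l2le_part; apply; exact: ltW.
Unshelve. all: by end_near. Qed.

Lemma l2le_delta m : l2le (@delta R m) 1.
Proof.
move=> N; have [mN|Nm] := ltnP m N.
  rewrite (bigD1_seq m) ?mem_index_iota ?iota_uniq//= big1 => [|k /negbTE km].
    by rewrite addr0 /delta eqxx /cabs ComplexField.Normc.normc1 expr1n.
  by rewrite /delta eq_sym km /cabs ComplexField.Normc.normc0 expr0n.
rewrite big_nat big1// => k /andP[_ kN].
rewrite /delta (gtn_eqF (leq_trans kN Nm)).
by rewrite /cabs ComplexField.Normc.normc0 expr0n.
Qed.

Lemma ell2_delta m : ell2 (@delta R m).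
Proof. exact: l2le_ell2 (l2le_delta m). Qed.

Lemma semigroup_sum t (a : nat -> R[i]) N : 0 <= t ->
  ell2 (fun k => \sum_(0 <= j < N) a j * @delta R j k) /\
  T t (fun k => \sum_(0 <= j < N) a j * @delta R j k) =
  (fun n => \sum_(0 <= j < N) a j * T t (@delta R j) n).
Proof.
move=> t0; elim: N => [|N [IH2 IH]].
  under eq_fun do rewrite big_nil; under [in RHS]eq_fun do rewrite big_nil.
  by split; [exact: ell2_0|exact: semigroup0].
under eq_fun do rewrite big_nat_recr//=.
under [in RHS]eq_fun do rewrite big_nat_recr//=.
have d2 : ell2 (fun k => a N * @delta R N k) by apply: ell2Z; exact: ell2_delta.
split; first exact: ell2D.
rewrite semigroupD// IH semigroupZ//; exact: ell2_delta.
Qed.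

(** The truncations of a square-summable sequence converge to it in norm, and
    [T t] is linear and contractive. *)
Lemma semigroup_expand t (a : nat -> R) b n : 0 <= t ->
  ell2 (fun k => (a k)%:C%C) ->
  \sum_(0 <= k < N) a k * part b (T t (@delta R k) n) @[N --> \oo] -->
    part b (T t (fun k => (a k)%:C%C) n).
Proof.
move=> t0 a2; have /ell2P[c ac] := a2.
pose S N := \sum_(0 <= k < N) cabs (a k)%:C%C ^+ 2.
have S_nd : {homo S : n m / (n <= m)%N >-> n <= m}.
  move=> p q pq; rewrite /S (big_cat_nat (leq0n _) pq)//=.
  by rewrite lerDl sumr_ge0// => *; exact: sqr_ge0.
have cvgS : cvgn S.
  by apply: nondecreasing_is_cvgn => //; exists c => _ [N _ <-]; exact: ac.
have SL N : S N <= limn S by exact: nondecreasing_cvgn_le.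
pose tr N k := \sum_(0 <= j < N) (a j)%:C%C * @delta R j k.
have trE N k : tr N k = if (k < N)%N then (a k)%:C%C else 0.
  rewrite /tr; case: ltnP => kN.
    rewrite (bigD1_seq k) ?mem_index_iota ?iota_uniq//= big1 => [|j /negbTE jk].
      by rewrite /delta eqxx mulr1 addr0.
    by rewrite /delta jk mulr0.
  rewrite big_nat big1// => j /= jN.
  by rewrite /delta ltn_eqF ?mulr0// (leq_trans jN).
have tail N : l2le (fun k => (a k)%:C%C - tr N k) (limn S - S N).
  move=> M; have [MN|NM] := leqP M N.
    rewrite big_nat big1 ?subr_ge0// => k /= kM.
    rewrite trE (leq_trans kM MN) subrr /cabs ComplexField.Normc.normc0.
    by rewrite expr0n.
  rewrite lerBrDl; apply: le_trans (SL M).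
  have -> : S M = S N + \sum_(N <= k < M) cabs (a k)%:C%C ^+ 2.
    by rewrite /S (big_cat_nat (leq0n _) (ltnW NM)).
  rewrite lerD2l.
  rewrite (big_cat_nat (leq0n _) (ltnW NM))//= big_nat big1 ?add0r => [|k /= kN].
    rewrite big_nat [leRHS]big_nat ler_sum// => k /andP[Nk _].
    by rewrite trE ltnNge Nk subr0.
  by rewrite trE kN subrr /cabs ComplexField.Normc.normc0 expr0n.
apply/cvgrPdist_le => e e0.
have /cvgrPdist_le/(_ (e ^+ 2)) := cvgS.
rewrite exprn_gt0// => /(_ isT) HN; near=> N.
have [tr2 Ttr] := semigroup_sum (fun k => (a k)%:C%C) N t0.
have : l2le (fun k => (a k)%:C%C - tr N k) (e ^+ 2).
  apply: l2leW (tail N); apply: le_trans (ler_norm _) _.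
  by near: N.
move=> /(semigroup_l2le t0); rewrite semigroupB// /tr Ttr.
move=> /(@l2le_part _ _ b n)/(_ (ltW e0)); rewrite partB.
suff -> : part b (\sum_(0 <= j < N) (a j)%:C%C * T t (@delta R j) n) =
  \sum_(0 <= k < N) a k * part b (T t (@delta R k) n) by [].
elim: (N) => [|M IH]; first by rewrite !big_nil; case: (b).
by rewrite !big_nat_recr//= partD IH partZ.
Unshelve. all: by end_near. Qed.

End Semigroup.

(** * The weight sigma and the conjugated operator *)

Section Weight.
Variables (R : realType) (alpha : R).
Hypothesis halpha : -1 < alpha.
Implicit Types (g f : nat -> R) (n m k : nat).
Local Notation sigma := (sigma alpha).

(** The operator conjugated by the weight, with polynomial coefficients in place
    of square roots. At n = 0 the junk value [g n.-1] has coefficient 0. *)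
Definition ltau g n : R :=
  - n%:R * g n.-1 + (2 * n%:R + 1 + alpha) * g n - (n%:R + 1 + alpha) * g n.+1.

Lemma ratio_gt0 n : 0 < n%:R + 1 + alpha.
Proof. by have := halpha; have := ler0n R n; lra. Qed.

Lemma sigma0 : sigma 0 = 1.
Proof. by rewrite /sigma /rising big_ord0 fact0 divr1 sqrtr1. Qed.

Lemma rising_gt0 n : 0 < rising (alpha + 1) n.
Proof.
elim: n => [|n IH]; rewrite /rising ?big_ord0// big_ord_recr/= mulr_gt0//.
by have := ratio_gt0 n; lra.
Qed.

Lemma sigma_gt0 n : 0 < sigma n.
Proof. by rewrite sqrtr_gt0 divr_gt0 ?rising_gt0// ltr0n fact_gt0. Qed.

Lemma sqr_sigmaS n : sigma n.+1 ^+ 2 * (n%:R + 1) =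
  sigma n ^+ 2 * (n%:R + 1 + alpha).
Proof.
have fact_neq0 m : m`!%:R != 0 :> R by rewrite pnatr_eq0 -lt0n fact_gt0.
rewrite !sqr_sqrtr ?divr_ge0 ?ler0n// ?ltW ?rising_gt0//.
rewrite /rising big_ord_recr/= factS natrM -natr1.
field; rewrite fact_neq0/=; have := ler0n R n; lra.
Qed.

Lemma sqrt_sigma n : Num.sqrt ((n%:R + 1) * (n%:R + 1 + alpha)) * sigma n =
  sigma n.+1 * (n%:R + 1).
Proof.
have n0 := ler0n R n; have an := ratio_gt0 n.
apply/eqP; rewrite -(@eqrXn2 _ 2%N)// ?mulr_ge0 ?sqrtr_ge0 ?addr_ge0//.
rewrite !exprMn sqr_sqrtr; last by rewrite mulr_ge0 ?(ltW an)// addr_ge0.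
apply/eqP; transitivity ((n%:R + 1) * (sigma n ^+ 2 * (n%:R + 1 + alpha))).
  by ring.
by rewrite -sqr_sigmaS; ring.
Qed.

Lemma sqrt_sigmaS n : Num.sqrt ((n%:R + 1) * (n%:R + 1 + alpha)) * sigma n.+1 =
  sigma n * (n%:R + 1 + alpha).
Proof.
apply: (mulfI (lt0r_neq0 (sigma_gt0 n))).
transitivity (Num.sqrt ((n%:R + 1) * (n%:R + 1 + alpha)) * sigma n *
  sigma n.+1); first by ring.
rewrite sqrt_sigma; transitivity (sigma n.+1 ^+ 2 * (n%:R + 1)); first by ring.
by rewrite sqr_sigmaS; ring.
Qed.

Lemma tau_sigma g : tau alpha (fun n => (sigma n * g n)%:C%C) =
  (fun n => (sigma n * ltau g n)%:C%C).
Proof.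
apply/funext => -[|n]; rewrite /tau /ltau.
  have := sqrt_sigmaS 0; rewrite mulr0n oppr0 mulr0 mul0r !add0r => H.
  rewrite -!rmorphM/= -rmorphB/=; congr (_%:C%C).
  by rewrite (mulrA (Num.sqrt _)) H; ring.
have := sqrt_sigmaS n.+1; have := sqrt_sigma n; rewrite !natr1 => H1 H2.
apply: part_inj => -[] /=; first by ring.
set q1 := Num.sqrt _ in H1 *; set q2 := Num.sqrt _ in H2 *.
transitivity (- (q1 * sigma n) * g n + (2 * n.+1%:R + 1 + alpha) * (sigma n.+1 * g n.+1)
  - q2 * sigma n.+2 * g n.+2); first by ring.
by rewrite H1 H2; ring.
Qed.

(** The last term vanishes for m = 0, where [m.-1] is junk. *)
Lemma tau_delta m : tau alpha (@delta R m) = (fun k =>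
  (2 * m%:R + 1 + alpha)%:C%C * @delta R m k
  - (Num.sqrt (m.+1%:R * (m.+1%:R + alpha)))%:C%C * @delta R m.+1 k
  - (Num.sqrt (m%:R * (m%:R + alpha)))%:C%C * @delta R m.-1 k).
Proof.
apply/funext => k; rewrite /tau /delta mulNr natr1.
have -> : (Num.sqrt (k%:R * (k%:R + alpha)))%:C%C *
    match k with | 0 => 0 | j.+1 => (m == j)%:R end =
    (Num.sqrt (m.+1%:R * (m.+1%:R + alpha)))%:C%C * (m.+1 == k)%:R :> R[i].
  case: k => [|j]; first by rewrite !mulr0.
  by rewrite eqSS; case: eqP => [->//|]; rewrite !mulr0.
have -> : (Num.sqrt (k.+1%:R * (k.+1%:R + alpha)))%:C%C * (m == k.+1)%:R =
    (Num.sqrt (m%:R * (m%:R + alpha)))%:C%C * (m.-1 == k)%:R :> R[i].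
  case: m => [|j]; first by rewrite mulr0 mul0r sqrtr0 mul0r.
  by rewrite eqSS/=; case: eqP => [->//|]; rewrite !mulr0.
have -> : (2 * k%:R + 1 + alpha)%:C%C * (m == k)%:R =
  (2 * m%:R + 1 + alpha)%:C%C * (m == k)%:R :> R[i].
  by case: eqP => [->//|]; rewrite !mulr0.
by ring.
Qed.

Lemma ell2_tau_delta m : ell2 (tau alpha (@delta R m)).
Proof.
rewrite tau_delta.
by apply: ell2B; [apply: ell2B|]; apply: ell2Z; exact: ell2_delta.
Qed.

Lemma laguerre_dom_delta m : laguerre_dom alpha (@delta R m).
Proof. split; [exact: ell2_delta|exact: ell2_tau_delta]. Qed.

Definition dominated k (Q A : R) g :=
  forall n, `|g n| <= A * ((n%:R + 1) ^+ k * Q ^+ n).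

(** [ltau] has coefficients of degree one and shifts indices by at most one. *)
Lemma ltau_dominated k Q : 0 < Q -> Q < 1 -> exists2 C, 0 <= C &
  forall A g, 0 <= A -> dominated k Q A g -> dominated k.+1 Q (C * A) (ltau g).
Proof.
have ha := halpha; move=> Q0 Q1.
exists (Q^-1 + (3 + alpha) + (2 + alpha) * 2 ^+ k).
  have : 0 <= Q^-1 by rewrite invr_ge0 ltW.
  have : 0 <= (2 + alpha) * 2 ^+ k by rewrite mulr_ge0 ?exprn_ge0//; lra.
  by lra.
move=> A g A0 gA n; rewrite /ltau.
set B := A * ((n%:R + 1) ^+ k * Q ^+ n).
have n0 := ler0n R n; have an := ratio_gt0 n.
have B0 : 0 <= B.
  by rewrite !mulr_ge0// exprn_ge0// ?addr_ge0// ltW.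
have -> : (Q^-1 + (3 + alpha) + (2 + alpha) * 2 ^+ k) * A *
    ((n%:R + 1) ^+ k.+1 * Q ^+ n) =
  (n%:R + 1) * (Q^-1 * B) + (n%:R + 1) * (3 + alpha) * B +
  (n%:R + 1) * (2 + alpha) * (2 ^+ k * B) by rewrite /B exprS; ring.
have H1 : n%:R * `|g n.-1| <= (n%:R + 1) * (Q^-1 * B).
  case: n @B n0 an B0 => [|n] B n0 an B0.
    by rewrite mul0r add0r mul1r mulr_ge0// invr_ge0 ltW.
  apply: ler_pM => //; first by lra.
  apply: le_trans (gA n) _.
  rewrite /B exprS (_ : Q^-1 * _ = A * ((n.+1%:R + 1) ^+ k * Q ^+ n)); last first.
    by field; exact: lt0r_neq0.
  rewrite ler_wpM2l// ler_wpM2r ?exprn_ge0 ?(ltW Q0)// lerXn2r ?nnegrE ?addr_ge0//.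
  by rewrite -natr1; lra.
have H2 : `|g n.+1| <= 2 ^+ k * B.
  apply: le_trans (gA n.+1) _; rewrite /B [leRHS]mulrCA ler_wpM2l// mulrA -exprMn.
  apply: ler_pM.
  - by rewrite exprn_ge0// addr_ge0.
  - by rewrite exprn_ge0// ltW.
  - by rewrite lerXn2r ?nnegrE ?addr_ge0 ?mulr_ge0 ?addr_ge0// -natr1; lra.
  - by rewrite exprS ger_pMl ?exprn_gt0// ltW.
apply: le_trans (ler_normB _ _) _; apply: lerD.
  apply: le_trans (ler_normD _ _) _; apply: lerD.
    by rewrite mulNr normrN normrM (ger0_norm n0).
  rewrite normrM (ger0_norm (_ : 0 <= _)); last by lra.
  by apply: ler_pM => //; [lra|nra].
rewrite normrM (gtr0_norm an); apply: ler_pM => //; [exact: ltW|nra].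
Qed.

(** The ratio of consecutive squares of [sigma] is 1 + alpha / (n + 1), which is
    at most (1 + 1 / (n + 1)) ^ p for any natural p >= alpha. *)
Lemma sqr_sigma_le : exists p, forall n, sigma n ^+ 2 <= (n%:R + 1) ^+ p.
Proof.
pose p := (Num.truncn `|alpha|).+1.
have ap : alpha <= p%:R.
  by apply: le_trans (ler_norm _) _; apply: ltW; rewrite truncnS_gt.
exists p; elim=> [|n IH]; first by rewrite sigma0 add0r !expr1n.
have n0 := ler0n R n.
have n1 : 0 < n%:R + 1 :> R by lra.
have -> : sigma n.+1 ^+ 2 = sigma n ^+ 2 * ((n%:R + 1 + alpha) / (n%:R + 1)).
  by rewrite mulrA -sqr_sigmaS mulfK// gt_eqF.
have -> : (n.+1%:R + 1) ^+ p = (n%:R + 1) ^+ p * ((n%:R + 2) / (n%:R + 1)) ^+ p :> R.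
  by rewrite -exprMn mulrCA divff ?gt_eqF// mulr1 -natr1; congr (_ ^+ p); ring.
apply: ler_pM => //; first exact: sqr_ge0.
  by rewrite divr_ge0 ?ltW// ratio_gt0.
have -> : (n%:R + 2) / (n%:R + 1) = 1 + (n%:R + 1)^-1 :> R.
  by field; rewrite gt_eqF.
have i0 : 0 <= (n%:R + 1)^-1 :> R by rewrite invr_ge0 ltW.
apply: le_trans (bernoulli_ineq _ _); last by lra.
rewrite ler_pdivrMr// mulrDl mul1r mulrAC -mulrA divff ?gt_eqF//; lra.
Qed.

Lemma dominated_l2le k Q : 0 < Q -> Q < 1 -> exists2 M, 0 <= M & forall A g,
  dominated k Q A g -> l2le (fun n => (sigma n * g n)%:C%C) (M * A ^+ 2).
Proof.
move=> Q0 Q1; have [p sp] := sqr_sigma_le.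
have [|M HM] := @sum_poly_geo_le R (p + k * 2) (Q ^+ 2).
  by rewrite exprn_ge0 ?ltW//= exprn_ilt1 ?ltW.
exists M; first by have := HM 0%N; rewrite big_nil.
move=> A g gA N; apply: (@le_trans _ _ (A ^+ 2 *
  \sum_(0 <= n < N) (n%:R + 1) ^+ (p + k * 2) * (Q ^+ 2) ^+ n)); last first.
  by rewrite mulrC ler_wpM2r ?sqr_ge0.
rewrite mulr_sumr; apply: ler_sum => n _.
rewrite sqr_cabs/= expr0n addr0 exprMn.
have -> : A ^+ 2 * ((n%:R + 1) ^+ (p + k * 2) * Q ^+ 2 ^+ n) =
  (n%:R + 1) ^+ p * (A * ((n%:R + 1) ^+ k * Q ^+ n)) ^+ 2.
  have -> : Q ^+ 2 ^+ n = Q ^+ n ^+ 2 by rewrite -!exprM mulnC.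
  by rewrite exprD exprM; ring.
apply: ler_pM; rewrite ?sqr_ge0//.
rewrite -[leLHS]real_normK ?num_real// lerXn2r ?nnegrE//.
exact: le_trans (gA n).
Qed.

End Weight.

(** * An explicit family of solutions *)

Section ExplicitSolution.
Variables (R : realType) (alpha : R).
Hypothesis halpha : -1 < alpha.
Local Notation sigma := (sigma alpha).
Local Notation ltau := (ltau alpha).

(** The orbit of geometric sequences under the heat flow: the conjugated
    operator acts on q ^ n through a first-order operator in q, whose
    characteristics are translations in r = 1 / (1 - q). *)
Definition geom (r : R) (n : nat) : R :=
  r `^ (- (1 + alpha)) * (1 - r^-1) ^+ n.

Lemma is_derive_geom n (r : R) : 0 < r ->
  is_derive r 1 (geom ^~ n) (- ltau (geom r) n).
Proof.
move=> r0; have rN0 : r != 0 by rewrite gt_eqF.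
have dP := is_derive1_powR (- (1 + alpha)) r0.
have dV := @is_deriveV R id r 1 1 rN0 (is_derive_id r 1).
have dx := is_deriveB (is_derive_cst (1 : R) r 1) dV.
have := is_deriveM dP (is_deriveX n dx).
rewrite (_ : _ * _ = geom ^~ n); last first.
  by apply/funext => s; rewrite /geom -[LHS]/(_ * (_ ^+ n) s) exprfctE.
move=> H; apply: (is_derive_eq H).
have powE : r `^ (- (1 + alpha) - 1) = r `^ (- (1 + alpha)) / r.
  by rewrite powRD ?rN0 ?implybT// powR_inv1 ?(ltW r0).
rewrite powE exprfctE /GRing.scale/= -![(cst 1 - _) r]/(1 - r^-1) /ltau /geom.
case: n {H} => [|n].
  by rewrite !expr0 !expr1 mulr0n; field; exact: rN0.
rewrite !exprS -!natr1 (_ : n.+1.-1 = n)//; field; exact: rN0.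
Qed.

Lemma geom_dominated (r Q : R) : 1 <= r -> 1 - r^-1 <= Q ->
  dominated 0 Q 1 (geom r).
Proof.
move=> r1 rQ n; rewrite /geom mul1r expr0 mul1r.
have ha := halpha.
have r0 : 0 < r by lra.
have x0 : 0 <= 1 - r^-1 by rewrite subr_ge0 invf_le1.
have p1 : r `^ (- (1 + alpha)) <= 1 by rewrite -[leRHS](powRr0 r) ler_powR//; lra.
rewrite ger0_norm ?mulr_ge0 ?powR_ge0 ?exprn_ge0//.
rewrite -[leRHS]mul1r ler_pM ?powR_ge0 ?exprn_ge0// lerXn2r ?nnegrE//.
exact: le_trans rQ.
Qed.

Lemma ltauB (f g : nat -> R) n :
  ltau (fun k => f k - g k) n = ltau f n - ltau g n.
Proof. by rewrite /ltau; ring. Qed.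

(** Two applications of the mean value theorem, the second to the derivative
    [- ltau (geom r)] itself, which by linearity of [ltau] is controlled by the
    increments of [geom]. *)
Lemma geom_increment Q : 0 < Q -> Q < 1 -> exists2 C, 0 <= C &
  forall r r', 1 <= r -> r <= r' -> 1 - r'^-1 <= Q ->
  dominated 1 Q (C * (r' - r)) (fun n => geom r' n - geom r n) /\
  dominated 2 Q (C * (r' - r) ^+ 2)
    (fun n => geom r' n - geom r n + (r' - r) * ltau (geom r) n).
Proof.
move=> Q0 Q1.
have [C0 C00 H0] := ltau_dominated halpha 0 Q0 Q1.
have [C1 C10 H1] := ltau_dominated halpha 1 Q0 Q1.
have mvt n (r r' : R) : 1 <= r -> r <= r' -> exists2 c, r <= c <= r' &
    geom r' n - geom r n = - ltau (geom c) n * (r' - r).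
  move=> r1 rr'; have [||c] := @MVT_segment _ (geom ^~ n)
    (fun s => - ltau (geom s) n) r r' rr'.
  - move=> x; rewrite in_itv/= => /andP[rx _].
    by apply: is_derive_geom; lra.
  - apply: derivable_within_continuous => x; rewrite in_itv/= => /andP[rx _].
    have x0 : 0 < x by lra.
    by have [] := is_derive_geom n x0.
  by rewrite in_itv/= => cI E; exists c.
have incr r r' : 1 <= r -> r <= r' -> 1 - r'^-1 <= Q ->
    dominated 1 Q (C0 * (r' - r)) (fun n => geom r' n - geom r n).
  move=> r1 rr' r'Q n; have [c /andP[rc cr'] ->] := mvt n r r' r1 rr'.
  have c1 : 1 <= c by lra.
  have : 1 - c^-1 <= Q.
    apply: le_trans r'Q; rewrite lerB// lef_pV2 ?posrE//; lra.
  move=> /(geom_dominated c1)/(H0 _ _ ler01)/(_ n).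
  rewrite mulr1 normrM normrN (ger0_norm (_ : 0 <= r' - r)) ?subr_ge0//.
  by move=> H; rewrite [C0 * _]mulrC -mulrA mulrC ler_wpM2l// subr_ge0.
exists (C0 + C1 * C0); first by rewrite addr_ge0// mulr_ge0.
move=> r r' r1 rr' r'Q; have d0 : 0 <= r' - r by rewrite subr_ge0.
have Qn0 k n : 0 <= (n%:R + 1) ^+ k * Q ^+ n.
  by rewrite mulr_ge0// exprn_ge0 ?addr_ge0// ltW.
split=> n.
  apply: le_trans (incr _ _ r1 rr' r'Q n) _.
  by rewrite ler_wpM2r// ler_wpM2r// lerDl mulr_ge0.
have [c /andP[rc cr'] ->] := mvt n r r' r1 rr'.
have cQ : 1 - c^-1 <= Q.
  apply: le_trans r'Q; rewrite lerB// lef_pV2 ?posrE//; lra.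
have := H1 _ _ (mulr_ge0 C00 (_ : 0 <= c - r)) (incr _ _ r1 rc cQ) n.
rewrite subr_ge0 => /(_ rc); rewrite ltauB => H.
have -> : - ltau (geom c) n * (r' - r) + (r' - r) * ltau (geom r) n =
  - ((r' - r) * (ltau (geom c) n - ltau (geom r) n)) by ring.
rewrite normrN normrM (ger0_norm d0).
apply: (@le_trans _ _ ((r' - r) * (C1 * (C0 * (r' - r)) *
   ((n%:R + 1) ^+ 2 * Q ^+ n)))).
  rewrite ler_wpM2l//; apply: le_trans H _.
  by rewrite ler_wpM2r// ler_wpM2l// ler_wpM2l// lerB.
set X := (n%:R + 1) ^+ 2 * Q ^+ n.
have -> : (r' - r) * (C1 * (C0 * (r' - r)) * X) = C1 * C0 * (r' - r) ^+ 2 * X.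
  by ring.
by rewrite ler_wpM2r ?Qn0// ler_wpM2r ?sqr_ge0// lerDr.
Qed.

Definition lgeom (r : R) (n : nat) : R[i] := (sigma n * geom r n)%:C%C.

Lemma tau_lgeom (r : R) :
  tau alpha (lgeom r) = fun n => (sigma n * ltau (geom r) n)%:C%C.
Proof. exact: tau_sigma. Qed.

Lemma ratio_lt1 (r : R) : 1 <= r -> 0 < 1 - (r + 1)^-1 /\ 1 - (r + 1)^-1 < 1.
Proof.
move=> r1; have r0 : 0 < r + 1 by lra.
split; last by rewrite gtrBl invr_gt0.
by rewrite subr_gt0 invf_lt1//; lra.
Qed.

Lemma laguerre_dom_lgeom (r : R) : 1 <= r -> laguerre_dom alpha (lgeom r).
Proof.
move=> r1; have [Q0 Q1] := ratio_lt1 r1.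
have gd : dominated 0 (1 - (r + 1)^-1) 1 (geom r).
  by apply: geom_dominated => //; rewrite lerB// lef_pV2 ?posrE//; lra.
split.
  have [M _ HM] := dominated_l2le halpha 0 Q0 Q1.
  exact: l2le_ell2 (HM _ _ gd).
have [C C0 HC] := ltau_dominated halpha 0 Q0 Q1.
have [M _ HM] := dominated_l2le halpha 1 Q0 Q1.
rewrite tau_lgeom; apply: l2le_ell2 (HM _ _ (HC _ _ ler01 gd)).
Qed.

Variable T : R -> (nat -> R[i]) -> (nat -> R[i]).
Hypothesis hT : semigroup_exp_neg (laguerre_dom alpha) (tau alpha) T.

(** The coordinatewise Taylor estimates of [geom_increment] are summed against
    [sigma ^+ 2]; the ratio 1 - 1 / (r + s + 1) dominates all the times up to
    s + 1, which covers a neighbourhood of s. *)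
Lemma semigroup_lgeom (t r : R) : 0 <= t -> 1 <= r ->
  T t (lgeom r) = lgeom (r + t).
Proof.
move=> t0 r1; rewrite -[in LHS](addr0 r).
apply: (semigroup_solution hT (U := fun s => lgeom (r + s))) => // [s s0|s e s0 e0|s e s0 e0].
- have rs1 : 1 <= r + s by lra.
  by have [d2 td2] := laguerre_dom_lgeom rs1.
- have rs1 : 1 <= r + s by lra.
  have [Q0 Q1] := ratio_lt1 rs1.
  have [C C0 HC] := geom_increment Q0 Q1.
  have [M M0 HM] := dominated_l2le halpha 2 Q0 Q1.
  near=> h.
  have h0 : 0 < h by near: h; exact: nbhs_right_gt.
  have h1 : h <= 1 by near: h; exact: nbhs_right_le.
  have he : h <= e / (M * C ^+ 2 + 1).
    near: h; apply: nbhs_right_le; rewrite divr_gt0//.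
    by rewrite ltr_pwDr// mulr_ge0// sqr_ge0.
  have [||| _] := HC (r + s) (r + (s + h)); [lra|lra| |].
    rewrite lerB// lef_pV2 ?posrE//; lra.
  have -> : r + (s + h) - (r + s) = h by ring.
  move=> /HM; set u := fun n => _.
  rewrite (_ : (fun n => lgeom _ n - _ + _) = u); last first.
    apply/funext => n; rewrite tau_lgeom /lgeom /u.
    by rewrite -rmorphB/= -rmorphM/= -rmorphD/=; congr (_%:C%C); ring.
  apply: l2leW; rewrite exprMn.
  have MC0 : 0 <= M * C ^+ 2 by rewrite mulr_ge0// sqr_ge0.
  have : h * (M * C ^+ 2 + 1) <= e by rewrite -ler_pdivlMr// ltr_pwDr.
  move=> he'.
  have he2 : M * C ^+ 2 * h <= e by nra.
  have -> : M * (C ^+ 2 * h ^+ 2 ^+ 2) = (M * C ^+ 2 * h) * h * h ^+ 2 by ring.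
  rewrite ler_wpM2r ?sqr_ge0//.
  have : 0 <= M * C ^+ 2 * h by rewrite mulr_ge0// ltW.
  nra.
have rs1 : 1 <= r + s by lra.
have [Q0 Q1] := ratio_lt1 rs1.
have [C C0 HC] := geom_increment Q0 Q1.
have [M M0 HM] := dominated_l2le halpha 1 Q0 Q1.
near=> h.
have h0 : 0 < h by near: h; exact: nbhs_right_gt.
have h1 : h <= 1 by near: h; exact: nbhs_right_le.
have hs : h <= s by near: h; exact: nbhs_right_le.
have he : h <= e / (M * C ^+ 2 + 1).
  near: h; apply: nbhs_right_le; rewrite divr_gt0//.
  by rewrite ltr_pwDr// mulr_ge0// sqr_ge0.
have [||| + _] := HC (r + (s - h)) (r + s); [lra|lra| |].
  rewrite lerB// lef_pV2 ?posrE//; lra.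
have -> : r + s - (r + (s - h)) = h by ring.
move=> /HM; set u := fun n => _.
rewrite (_ : (fun n => lgeom _ n - _) = u); last first.
  apply/funext => n; rewrite /lgeom /u.
  by rewrite -rmorphB/=; congr (_%:C%C); ring.
apply: l2leW; rewrite exprMn.
have MC0 : 0 <= M * C ^+ 2 by rewrite mulr_ge0// sqr_ge0.
have : h * (M * C ^+ 2 + 1) <= e by rewrite -ler_pdivlMr// ltr_pwDr.
move=> he'.
have he2 : M * C ^+ 2 * h <= e by nra.
have -> : M * (C ^+ 2 * h ^+ 2) = (M * C ^+ 2 * h) * h by ring.
have : 0 <= M * C ^+ 2 * h by rewrite mulr_ge0// ltW.
nra.
Unshelve. all: by end_near. Qed.

End ExplicitSolution.

(** * Differential-difference systems *)

Section Ladder.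
Variable R : realType.
Implicit Types (g a b : nat -> R -> R) (f : R -> R) (t d beta : R).

Lemma cvg_near_eq {X : Type} {F : set_system X} {FF : Filter F} (f f' : X -> R)
    (l : R) : f @ F --> l -> (\forall x \near F, f x = f' x) -> f' @ F --> l.
Proof.
by move=> fl ff'; apply: cvg_trans fl; exact: near_eq_cvg.
Qed.

Definition rdiff f t d := (f (t + h) - f t) / h @[h --> 0^'+] --> d.

Lemma rdiff_uniq f t d d' : rdiff f t d -> rdiff f t d' -> d = d'.
Proof. by move=> H H'; exact: cvg_unique H H'. Qed.

Lemma eq_rdiff f f' t d : (forall s, t <= s -> f s = f' s) ->
  rdiff f t d -> rdiff f' t d.
Proof.
move=> ff' H; apply: cvg_near_eq H _; near=> h.
rewrite -!ff'// lerDl ltW//; near: h; exact: nbhs_right_gt.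
Unshelve. all: by end_near. Qed.

Lemma rdiff_cst (c : R) t : rdiff (fun=> c) t 0.
Proof.
rewrite /rdiff; under eq_fun do rewrite subrr mul0r.
exact: cvg_cst.
Qed.

Lemma rdiffD f f' t d d' : rdiff f t d -> rdiff f' t d' ->
  rdiff (fun s => f s + f' s) t (d + d').
Proof.
move=> H H'; apply: cvg_near_eq (cvgD H H') _.
by near=> h; rewrite -[LHS]/(_ + _) -mulrDl; congr (_ / _); ring.
Unshelve. all: by end_near. Qed.

Lemma rdiffZ c f t d : rdiff f t d -> rdiff (fun s => c * f s) t (c * d).
Proof.
move=> H; apply: cvg_near_eq (cvgM (cvg_cst c) H) _.
by near=> h; rewrite -[LHS]/(c * ((f (t + h) - f t) / h)) mulrA mulrBr.
Unshelve. all: by end_near. Qed.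

Lemma rdiffB f f' t d d' : rdiff f t d -> rdiff f' t d' ->
  rdiff (fun s => f s - f' s) t (d - d').
Proof.
move=> H /(@rdiffZ (-1)) H'; rewrite -mulN1r.
apply: eq_rdiff (rdiffD H H') => s _; by rewrite mulN1r.
Qed.

Lemma rdiff_right_continuous f t d : rdiff f t d ->
  f (t + h) @[h --> 0^'+] --> f t.
Proof.
move=> H.
have h0 : (h : R) @[h --> 0^'+] --> (0 : R).
  exact: (cvg_at_right_filter cvg_id).
have <- : 0 * d + f t = f t by ring.
apply: cvg_near_eq (cvgD (cvgM h0 H) (cvg_cst (f t))) _; near=> h.
have hN0 : h != 0 by apply: lt0r_neq0; near: h; exact: nbhs_right_gt.
rewrite -[LHS]/(h * ((f (t + h) - f t) / h) + f t); field; exact: hN0.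
Unshelve. all: by end_near. Qed.

Lemma rdiff_mul_id f t d : rdiff f t d ->
  rdiff (fun s => s * f s) t (f t + t * d).
Proof.
move=> H; apply: cvg_near_eq (cvgD (rdiff_right_continuous H) (@rdiffZ t _ _ _ H)) _.
near=> h.
have hN0 : h != 0 by apply: lt0r_neq0; near: h; exact: nbhs_right_gt.
rewrite -[LHS]/(f (t + h) + (t * f (t + h) - t * f t) / h); field; exact: hN0.
Unshelve. all: by end_near. Qed.

Lemma is_derive_rdiff f t d : is_derive t 1 f d -> rdiff f t d.
Proof.
move=> [df <-]; have /cvg_dnbhs_at_right : cvg_to
  (h^-1 *: ((f \o shift t) (h *: (1 : R)) - f t) @[h --> 0^']) (nbhs ('D_1 f t)).
  exact: df.
move=> H; apply: cvg_near_eq H _; near=> h.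
by rewrite /= /GRing.scale/= mulr1 (addrC h t) mulrC.
Unshelve. all: by end_near. Qed.

(** The sequence shifted by one, with the convention g_(-1) = 0. *)
Definition lower g m : R -> R := if m is p.+1 then g p else fun=> 0.

(** The equation in (t, m) satisfied by each row of the heat kernel, kept for a
    general parameter because [ladder_combine] lowers it by one. *)
Definition ladder beta g := forall t m, 0 <= t ->
  rdiff (g m) t ((m%:R + 1) * g m.+1 t - (2 * m%:R + 1 + beta) * g m t
                 + (m%:R + beta) * lower g m t).

(** The coefficient m + 1 of g_(m+1) does not vanish, so that each term is
    determined by the two before it and their derivatives. *)
Lemma ladder_eq0 beta g : ladder beta g -> (forall t, 0 <= t -> g 0 t = 0) ->
  forall m t, 0 <= t -> g m t = 0.
Proof.
move=> lg g0 m; suff : forall t, 0 <= t -> g m t = 0 /\ lower g m t = 0.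
  by move=> H t /H[].
elim: m => [|m IH] t t0; first by split=> //; exact: g0.
have [gm gp] := IH t t0; split=> //.
have := lg t m t0; rewrite gm gp !mulr0 addr0 subr0 => H.
have : rdiff (g m) t 0.
  by apply: eq_rdiff (rdiff_cst 0 t) => s ts; have [] := IH s (le_trans t0 ts).
move=> /(rdiff_uniq H)/eqP; rewrite mulf_eq0 => /orP[|/eqP//].
by rewrite natr1 pnatr_eq0.
Qed.

Lemma ladderB beta a b : ladder beta a -> ladder beta b ->
  ladder beta (fun m s => a m s - b m s).
Proof.
move=> la lb t m t0; have := rdiffB (la t m t0) (lb t m t0).
congr (rdiff _ t _); case: m => [|m] /=; ring.
Qed.

(** In terms of generating functions in q, a ladder is the transport equation
    with field (1 - q) ^ 2 and zero-order term - (1 + beta) (1 - q). The factors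
    1 + t - t q and t + (1 - t) q of the combination are both multiplied by
    1 - q under this transport, which lowers beta by one. *)
Lemma ladder_combine beta a b : ladder beta a -> ladder beta b ->
  ladder (beta - 1) (fun m s => (1 + s) * a m s - s * lower a m s
                                - s * b m s - (1 - s) * lower b m s).
Proof.
move=> la lb t m t0.
pose lower2 g k : R := if k is p.+2 then g p t else 0.
have rlower g k : ladder beta g -> rdiff (lower g k) t (k%:R * g k t
    - (2 * k%:R - 1 + beta) * lower g k t + (k%:R - 1 + beta) * lower2 g k).
  move=> lg; case: k => [|k].
    by rewrite /= !mulr0 mul0r subr0 addr0; exact: rdiff_cst.
  have := lg t k t0; congr (rdiff _ t _).
  by rewrite -[lower g k.+1]/(g k) -natr1; case: k => [|k] /=; ring.
have Ra := la t m t0; have Rb := lb t m t0.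
have Rpa := rlower a m la; have Rpb := rlower b m lb.
have := rdiffB (rdiffB (rdiffB (rdiffD Ra (rdiff_mul_id Ra)) (rdiff_mul_id Rpa))
  (rdiff_mul_id Rb)) (rdiffB Rpb (rdiff_mul_id Rpb)).
congr (rdiff _ t _); first by apply/funext => s; ring.
have -> : lower (fun m s => (1 + s) * a m s - s * lower a m s - s * b m s -
    (1 - s) * lower b m s) m t = (1 + t) * lower a m t - t * lower2 a m
    - t * lower b m t - (1 - t) * lower2 b m.
  by case: m {Ra Rb Rpa Rpb} => [|[|m]] /=; ring.
move: (lower2 a m) (lower2 b m) => a2 b2.
rewrite -[lower a m.+1]/(a m) -[lower b m.+1]/(b m); ring.
Qed.

End Ladder.

(** * The heat kernel *)

Section Kernel.
Variables (R : realType) (alpha : R).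
Hypothesis halpha : -1 < alpha.
Variable T : R -> (nat -> R[i]) -> (nat -> R[i]).
Hypothesis hT : semigroup_exp_neg (laguerre_dom alpha) (tau alpha) T.
Local Notation sigma := (sigma alpha).
Local Notation geom := (geom alpha).

(** The kernel (e^(-t H~) delta_m)_n of the conjugated semigroup. *)
Definition hkernel_part b n m (t : R) : R :=
  part b (T t (@delta R m) n) * (sigma m / sigma n).

Lemma semigroup_tau_delta b n m (t : R) : 0 <= t ->
  part b (T t (tau alpha (@delta R m)) n) * (sigma m / sigma n) =
  - ((m%:R + 1) * hkernel_part b n m.+1 t
     - (2 * m%:R + 1 + alpha) * hkernel_part b n m t
     + (m%:R + alpha) * lower (hkernel_part b n) m t).
Proof.
move=> t0; rewrite tau_delta.
have dZ (c : R[i]) k : ell2 (fun j => c * @delta R k j).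
  by apply: ell2Z; exact: ell2_delta.
rewrite (semigroupB hT)//; last exact: ell2B.
rewrite (semigroupB hT)// !(semigroupZ hT)//; do ?exact: ell2_delta.
rewrite !partB !partZ /hkernel_part.
have sn := lt0r_neq0 (sigma_gt0 halpha n).
have := sqrt_sigma halpha m; rewrite !natr1 => H1.
rewrite !mulrBl [in LHS](mulrAC (Num.sqrt (m.+1%:R * _))).
have -> : Num.sqrt (m.+1%:R * (m.+1%:R + alpha)) * (sigma m / sigma n) =
   sigma m.+1 * m.+1%:R / sigma n by rewrite mulrA H1.
case: m H1 => [|m] H1 /=; first by rewrite mul0r sqrtr0; ring.
have := sqrt_sigmaS halpha m; rewrite !natr1 => H2.
rewrite [X in _ - X]mulrAC.
have -> : Num.sqrt (m.+1%:R * (m.+1%:R + alpha)) * (sigma m.+1 / sigma n) =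
   sigma m * (m.+1%:R + alpha) / sigma n by rewrite mulrA H2.
ring.
Qed.

Lemma hkernel_part_ladder b n : ladder alpha (hkernel_part b n).
Proof.
move=> t m t0.
set d := (X in rdiff _ _ X).
apply/cvgrPdist_le => e e0.
have c0 : 0 < sigma m / sigma n by rewrite divr_gt0 ?sigma_gt0.
have e'0 : 0 < (e / (sigma m / sigma n)) ^+ 2.
  by rewrite exprn_gt0// divr_gt0.
have [d2 td2] := laguerre_dom_delta alpha m.
have := semigroup_deriv hT t0 (laguerre_dom_delta alpha m) d2 td2 e'0.
move=> H; near=> h.
have h0 : 0 < h by near: h; exact: nbhs_right_gt.
have : l2le (fun n => T (t + h) (@delta R m) n - T t (@delta R m) n +
    h%:C%C * T t (tau alpha (@delta R m)) n) ((e / (sigma m / sigma n)) ^+ 2 * h ^+ 2)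
  by near: h.
rewrite -exprMn => /(@l2le_part _ _ _ b n).
move=> /(_ (mulr_ge0 (ltW (divr_gt0 e0 c0)) (ltW h0))).
rewrite partD partB partZ => Hh.
have E := semigroup_tau_delta b n m t0; rewrite -/d in E.
rewrite -(opprK d) -E.
have -> : - (part b (T t (tau alpha (@delta R m)) n) * (sigma m / sigma n)) -
    (hkernel_part b n m (t + h) - hkernel_part b n m t) / h =
  - (sigma m / sigma n / h * (part b (T (t + h) (@delta R m) n) -
    part b (T t (@delta R m) n) + h * part b (T t (tau alpha (@delta R m)) n))).
  rewrite /hkernel_part; field; rewrite !gt_eqF ?sigma_gt0//.
have q0 : 0 < sigma m / sigma n / h by rewrite divr_gt0.
rewrite normrN normrM (gtr0_norm q0).
apply: le_trans (ler_wpM2l (ltW q0) Hh) _.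
rewrite le_eqVlt; apply/orP; left; apply/eqP; field.
by rewrite !gt_eqF ?sigma_gt0.
Unshelve. all: by end_near. Qed.

Lemma delta0_lgeom : @delta R 0 = lgeom alpha 1.
Proof.
apply/funext => -[|n]; rewrite /delta /lgeom /geom powR1 invr1 subrr.
  by rewrite sigma0 expr0 !mulr1.
by rewrite expr0n/= !mulr0.
Qed.

(** The imaginary parts of a row form a ladder, and the one in column 0 vanishes
    by the explicit formula. *)
Lemma semigroup_delta_real (t : R) n m : 0 <= t ->
  T t (@delta R m) n = (complex.Re (T t (@delta R m) n))%:C%C.
Proof.
move=> t0; suff : complex.Im (T t (@delta R m) n) = 0.
  by case: (T t _ n) => x y /= ->.
have := ladder_eq0 (@hkernel_part_ladder true n) _ m t0.
rewrite /hkernel_part/= => H; have /eqP : complex.Im (T t (@delta R m) n) *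
  (sigma m / sigma n) = 0.
  apply: H => s s0; rewrite delta0_lgeom (semigroup_lgeom halpha hT)//.
  by rewrite mul0r.
by rewrite mulf_eq0 (gt_eqF (divr_gt0 (sigma_gt0 halpha m) (sigma_gt0 halpha n))) orbF => /eqP.
Qed.

Definition hkernel n m t := hkernel_part false n m t.

Lemma hkernel_ladder n : ladder alpha (hkernel n).
Proof. exact: hkernel_part_ladder. Qed.

Lemma hkernel_n0 n t : 0 <= t -> hkernel n 0 t = geom (1 + t) n.
Proof.
move=> t0; rewrite /hkernel /hkernel_part delta0_lgeom.
rewrite (semigroup_lgeom halpha hT)//= sigma0; field.
by rewrite gt_eqF ?sigma_gt0.
Qed.

Lemma geom_ladder : ladder alpha (fun m t => sigma m ^+ 2 * geom (1 + t) m).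
Proof.
move=> t m t0.
have t1 : 0 < 1 + t by lra.
have dg : is_derive t 1 (fun s => geom (1 + s) m) (- ltau alpha (geom (1 + t)) m).
  have ds : is_derive t 1 (fun s : R => 1 + s) 1.
    by apply: is_derive_eq (is_deriveD (is_derive_cst (1 : R) t 1)
      (is_derive_id t 1)) _; rewrite add0r.
  have := @is_derive1_comp _ (geom ^~ m) (fun s : R => 1 + s) t _ _
    (is_derive_geom alpha m t1) ds.
  by rewrite mulr1.
have := @rdiffZ _ (sigma m ^+ 2) _ _ _ (is_derive_rdiff dg).
congr (rdiff _ t _); rewrite /ltau.
have H1 := sqr_sigmaS halpha m.
have -> : sigma m ^+ 2 * - (- m%:R * geom (1 + t) m.-1 +
    (2 * m%:R + 1 + alpha) * geom (1 + t) m -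
    (m%:R + 1 + alpha) * geom (1 + t) m.+1) =
    sigma m ^+ 2 * m%:R * geom (1 + t) m.-1 -
    (2 * m%:R + 1 + alpha) * (sigma m ^+ 2 * geom (1 + t) m) +
    (sigma m ^+ 2 * (m%:R + 1 + alpha)) * geom (1 + t) m.+1 by ring.
rewrite -H1; case: m {dg H1} => [|m] /=; first by ring.
have := sqr_sigmaS halpha m; rewrite !natr1 => ->; ring.
Qed.

(** Both sides are ladders and they agree in column 0. *)
Lemma hkernel_0n m t : 0 <= t -> hkernel 0 m t = sigma m ^+ 2 * geom (1 + t) m.
Proof.
move=> t0; apply/eqP; rewrite -subr_eq0; apply/eqP.
apply: (ladder_eq0 (ladderB (@hkernel_ladder 0) geom_ladder)) => // s s0.
by rewrite hkernel_n0// sigma0; ring.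
Qed.

Lemma geomS (t : R) n : 0 <= t -> (1 + t) * geom (1 + t) n.+1 = t * geom (1 + t) n.
Proof.
by move=> t0; rewrite /geom exprS; field; rewrite gt_eqF//; lra.
Qed.

(** Extracts coefficients from F_(n+1)(q) (1 + t - t q) = F_n(q) (t + (1 - t) q),
    where F_n(q) is the sum over m of K_t(n, m) q ^ m. The difference of the two
    sides is a ladder of parameter alpha - 1 that vanishes in column 0. *)
Lemma hkernel_recurrence n m t : 0 <= t ->
  (1 + t) * hkernel n.+1 m t = t * lower (hkernel n.+1) m t
    + t * hkernel n m t + (1 - t) * lower (hkernel n) m t.
Proof.
move=> t0; have H := ladder_eq0 (ladder_combine (@hkernel_ladder n.+1)
  (@hkernel_ladder n)) _ m t0.
apply/eqP; rewrite -subr_eq0 -[X in _ == X](H _) => [|s s0 /=].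
  by apply/eqP; ring.
by rewrite !hkernel_n0// geomS//; ring.
Qed.

Lemma geom_ge0 (r : R) n : 1 <= r -> 0 <= geom r n.
Proof.
move=> r1; rewrite mulr_ge0 ?powR_ge0 ?exprn_ge0// subr_ge0 invf_le1//; lra.
Qed.

(** For t <= 1 every coefficient of the recurrence is nonnegative. *)
Lemma hkernel_ge0_small n m t : 0 <= t -> t <= 1 -> 0 <= hkernel n m t.
Proof.
move=> t0 t1; elim: n m => [|n IHn] m.
  by rewrite hkernel_0n// mulr_ge0 ?sqr_ge0// geom_ge0//; lra.
have t10 : 0 < 1 + t by lra.
elim: m => [|m IHm]; rewrite -(pmulr_rge0 _ t10) hkernel_recurrence//.
  by rewrite /= !mulr0 addr0 add0r mulr_ge0.
by rewrite !addr_ge0// mulr_ge0//=; lra.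
Qed.

Lemma chapman_kolmogorov n m s t : 0 <= s -> 0 <= t ->
  \sum_(0 <= k < N) hkernel n k s * hkernel k m t @[N --> \oo] -->
    hkernel n m (s + t).
Proof.
move=> s0 t0; have st0 : 0 <= s + t by rewrite addr_ge0.
rewrite /hkernel /hkernel_part (semigroup_add hT)//; last exact: ell2_delta.
have E : T t (@delta R m) = fun k => (complex.Re (T t (@delta R m) k))%:C%C.
  by apply/funext => k; rewrite -semigroup_delta_real.
have := semigroup_ell2 hT t0 (ell2_delta R m); rewrite {1}E => E2.
have := semigroup_expand hT (b := false) (n := n) s0 E2; rewrite -E => H.
apply: cvg_near_eq (cvgM H (cvg_cst (sigma m / sigma n))) _; near=> N.
rewrite /= mulr_suml; apply: eq_bigr => k _; field.
by rewrite !gt_eqF ?sigma_gt0.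
Unshelve. all: by end_near. Qed.

(** Halve t until it is at most 1 and use the Chapman-Kolmogorov equation. *)
Lemma hkernel_ge0 n m t : 0 <= t -> 0 <= hkernel n m t.
Proof.
move=> t0; have [p tp] : exists p, t <= 2 ^+ p.
  exists (Num.truncn t).+1; apply: le_trans (ltW (truncnS_gt _)) _.
  by rewrite -natrX ler_nat ltnW// ltn_expl.
elim: p t t0 tp n m => [|p IH] t t0 tp n m; first exact: hkernel_ge0_small.
have t20 : 0 <= t / 2 by rewrite divr_ge0.
have t2p : t / 2 <= 2 ^+ p by rewrite ler_pdivrMr// mulrC -exprS.
have -> : t = t / 2 + t / 2 by lra.
have H := @chapman_kolmogorov n m _ _ t20 t20.
rewrite -(cvg_lim _ H)//; apply: limr_ge; first by apply/cvg_ex; eexists; exact: H.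
by apply: nearW => N; apply: sumr_ge0 => k _; rewrite mulr_ge0// IH.
Qed.

Lemma hkernel_mul_le n k m s t : 0 <= s -> 0 <= t ->
  hkernel n k s * hkernel k m t <= hkernel n m (s + t).
Proof.
move=> s0 t0; have H := @chapman_kolmogorov n m _ _ s0 t0.
rewrite -(cvg_lim _ H)//; apply: limr_ge; first by apply/cvg_ex; eexists; exact: H.
near=> N; have kN : (k < N)%N by near: N; exact: nbhs_infty_gt.
rewrite (bigD1_seq k) ?mem_index_iota ?iota_uniq//= lerDl.
by apply: sumr_ge0 => j _; rewrite mulr_ge0 ?hkernel_ge0.
Unshelve. all: by end_near. Qed.

Lemma hkernel_geom n r t : 1 <= r -> 0 <= t ->
  \sum_(0 <= k < N) hkernel n k t * geom r k @[N --> \oo] --> geom (r + t) n.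
Proof.
move=> r1 t0; have [g2 _] := laguerre_dom_lgeom halpha r1.
have := semigroup_expand hT (b := false) (n := n) t0 g2.
rewrite -[T t (fun k => (_ * _)%:C%C)]/(T t (lgeom alpha r)).
rewrite (semigroup_lgeom halpha hT)// => H.
have <- : part false (lgeom alpha (r + t) n) * (sigma n)^-1 = geom (r + t) n.
  by rewrite /=; field; rewrite gt_eqF ?sigma_gt0.
apply: cvg_near_eq (cvgM H (cvg_cst (sigma n)^-1)) _; near=> N.
rewrite /= mulr_suml; apply: eq_bigr => k _; rewrite /hkernel /hkernel_part/=.
by field; rewrite !gt_eqF ?sigma_gt0.
Unshelve. all: by end_near. Qed.

Lemma tilde_delta n m t : 0 <= t ->
  tilde alpha T t (@delta R m) n = (hkernel n m t)%:C%C.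
Proof.
move=> t0; rewrite /tilde /Lmap_inv.
have -> : Lmap alpha (@delta R m) = fun k => (sigma m)%:C%C * @delta R m k.
  apply/funext => k; rewrite /Lmap /delta; case: eqP => [->//|_].
  by rewrite !mulr0.
rewrite (semigroupZ hT)//; last exact: ell2_delta.
rewrite semigroup_delta_real// -!rmorphM/=; congr (_%:C%C).
by rewrite /hkernel /hkernel_part/=; ring.
Qed.

End Kernel.

(** * Stochastic completeness *)

Section Completeness.
Variables (R : realType) (alpha : R).
Hypothesis halpha : -1 < alpha.
Variable T : R -> (nat -> R[i]) -> (nat -> R[i]).
Hypothesis hT : semigroup_exp_neg (laguerre_dom alpha) (tau alpha) T.
Local Notation hkernel := (hkernel alpha T).
Local Notation geom := (geom alpha).
Local Notation pow r := (r `^ (- (1 + alpha))).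

Lemma le_pow (r s : R) : 0 < r -> r <= s -> pow s <= pow r.
Proof.
move=> r0 rs; have ha := halpha; have s0 : 0 < s by lra.
rewrite !powRN lef_pV2 ?posrE ?powR_gt0//.
by apply: ge0_ler_powR; rewrite ?nnegrE; lra.
Qed.

(** The sum over k of K_t(n, k) (1 - 1 / r) ^ k is at most 1, since
    [geom (r + t) n <= pow r]; let r tend to infinity. *)
Lemma sum_hkernel_le1 n N t : 0 <= t -> \sum_(0 <= k < N) hkernel n k t <= 1.
Proof.
move=> t0; set S := \sum_(0 <= k < N) _.
have S0 : 0 <= S by apply: sumr_ge0 => k _; exact: hkernel_ge0.
apply: (@ler_of_inv R _ _ (N%:R * S)); first by rewrite mulr_ge0.
move=> r r1; have r0 : 0 < r by lra.
have rt0 : 0 < r + t by lra.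
have Hc := hkernel_geom halpha hT (n := n) r1 t0.
have H1 : \sum_(0 <= k < N) hkernel n k t * geom r k <= geom (r + t) n.
  rewrite -(cvg_lim _ Hc)//; apply: (@nondecreasing_cvgn_le _
    (fun N => \sum_(0 <= k < N) hkernel n k t * geom r k)).
    move=> p q pq; rewrite (big_cat_nat (leq0n _) pq)//= lerDl sumr_ge0// => k _.
    by rewrite mulr_ge0 ?hkernel_ge0 ?geom_ge0.
  by apply/cvg_ex; eexists; exact: Hc.
have H2 : geom (r + t) n <= pow r.
  apply: (@le_trans _ _ (pow (r + t))); last by apply: le_pow => //; lra.
  rewrite /geom ger_pMr ?powR_gt0// exprn_ile1 ?subr_ge0 ?invf_le1//; try lra.
  by rewrite gerBl invr_ge0 ltW.
have H3 : pow r * ((1 - N%:R / r) * S) <= \sum_(0 <= k < N) hkernel n k t * geom r k.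
  rewrite !mulr_sumr big_nat [leRHS]big_nat; apply: ler_sum => k /andP[_ kN].
  rewrite /geom [leRHS]mulrCA ler_wpM2l ?powR_ge0//.
  rewrite mulrC ler_wpM2l ?hkernel_ge0//.
  have ir : 0 <= r^-1 <= 1 by rewrite invr_ge0 ltW//= invf_le1.
  apply: le_trans (bernoulli_sub k ir); rewrite lerD2l lerN2 ler_wpM2r//.
    by rewrite invr_ge0 ltW.
  by rewrite ler_nat ltnW.
have := le_trans H3 (le_trans H1 H2).
rewrite -[leRHS]mulr1 ler_pM2l ?powR_gt0// => H.
have -> : N%:R * S / r = N%:R / r * S by rewrite mulrAC.
by move: H; rewrite mulrBl mul1r; lra.
Qed.

(** Bernoulli's inequality with a natural exponent p in place of 1 + alpha, as
    the base r / (r + t) is at most 1. *)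
Lemma pow_ratio_ge (p : nat) (r t : R) : 1 + alpha <= p%:R -> 1 <= r -> 0 <= t ->
  (1 - p%:R * (t / (r + t))) * pow r <= pow (r + t).
Proof.
move=> ap r1 t0; have rt0 : 0 < r + t by lra.
have r0 : 0 < r by lra.
have tr : 0 <= t / (r + t) <= 1.
  by rewrite divr_ge0 ?(ltW rt0)//= ler_pdivrMr// mul1r; lra.
have q01 : 0 < r / (r + t) <= 1 by rewrite divr_gt0//= ler_pdivrMr// mul1r; lra.
apply: (@le_trans _ _ ((r / (r + t)) `^ (1 + alpha) * pow r)).
  rewrite ler_wpM2r ?powR_ge0//.
  apply: (@le_trans _ _ ((r / (r + t)) `^ p%:R)); last exact: ger_powR.
  rewrite powR_mulrn; last by case/andP: q01 => /ltW.
  have -> : r / (r + t) = 1 - t / (r + t) by field; rewrite gt_eqF.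
  exact: bernoulli_sub.
rewrite powRM ?invr_ge0 ?(ltW r0) ?(ltW rt0)// mulrAC powRN.
rewrite divff ?gt_eqF ?powR_gt0// mul1r.
by rewrite -powR_inv1 ?(ltW rt0)// -powRrM mulN1r.
Qed.

(** A limit L of the partial sums satisfies [geom (r + t) n <= L * pow r], and
    the ratio of [geom (r + t) n] to [pow r] tends to 1 at infinity, with an
    error of order 1 / r. *)
Lemma cvg_sum_hkernel n t : 0 <= t ->
  \sum_(0 <= k < N) hkernel n k t @[N --> \oo] --> (1 : R).
Proof.
move=> t0; set S := fun N => _.
have S_nd : {homo S : p q / (p <= q)%N >-> p <= q}.
  move=> p q pq; rewrite /S (big_cat_nat (leq0n _) pq)//= lerDl sumr_ge0// => k _.
  exact: hkernel_ge0.
have S1 N : S N <= 1 by exact: sum_hkernel_le1.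
have cS : cvgn S.
  by apply: nondecreasing_is_cvgn => //; exists 1 => _ [N _ <-].
suff <- : limn S = 1 by [].
apply/eqP; rewrite eq_le; apply/andP; split.
  by apply: limr_le => //; apply: nearW.
set L := limn S.
have SL N : S N <= L by exact: nondecreasing_cvgn_le.
pose p := (Num.truncn (1 + alpha)).+1.
have ap : 1 + alpha <= p%:R by exact/ltW/truncnS_gt.
have L0 : 0 <= L by apply: le_trans (SL 0%N); rewrite /S big_nil.
apply: (@ler_of_inv R _ _ (p%:R * t + n%:R)); first by rewrite addr_ge0// mulr_ge0.
move=> r r1; have r0 : 0 < r by lra.
have rt0 : 0 < r + t by lra.
have Hc := hkernel_geom halpha hT (n := n) r1 t0.
have H1 : geom (r + t) n <= L * pow r.
  rewrite -(cvg_lim _ Hc)//; apply: limr_le; first by apply/cvg_ex; eexists; exact: Hc.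
  apply: nearW => N; apply: (@le_trans _ _ (S N * pow r)); last first.
    by rewrite ler_wpM2r ?powR_ge0.
  rewrite mulr_suml; apply: ler_sum => k _; rewrite ler_wpM2l ?hkernel_ge0//.
  rewrite /geom ger_pMr ?powR_gt0// exprn_ile1 ?subr_ge0 ?invf_le1//.
  by rewrite gerBl invr_ge0 ltW.
have itr : 0 <= (r + t)^-1 <= 1 by rewrite invr_ge0 ltW//= invf_le1//; lra.
have xn1 : (1 - (r + t)^-1) ^+ n <= 1.
  rewrite exprn_ile1//; first by rewrite subr_ge0; case/andP: itr.
  by rewrite gerBl; case/andP: itr.
have xn0 : 0 <= (1 - (r + t)^-1) ^+ n.
  by rewrite exprn_ge0// subr_ge0; case/andP: itr.
have Hp := pow_ratio_ge ap r1 t0.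
have Hb := bernoulli_sub n itr.
set x := (1 - (r + t)^-1) ^+ n in xn1 xn0 Hb.
set B := p%:R * (t / (r + t)) in Hp.
set C := n%:R * (r + t)^-1 in Hb.
have B0 : 0 <= B by rewrite /B mulr_ge0// divr_ge0// ltW.
have H2 : (1 - B) * x <= L.
  have := H1; rewrite /geom -/x => H1'.
  have H3 : (1 - B) * pow r * x <= L * pow r.
    by apply: le_trans H1'; rewrite ler_wpM2r.
  by move: H3; rewrite mulrAC ler_pM2r ?powR_gt0.
have H4 : 1 <= L + (B + C) by nra.
apply: (le_trans H4); rewrite lerD2l.
have -> : B + C = (p%:R * t + n%:R) / (r + t) by rewrite /B /C; field; rewrite gt_eqF.
rewrite ler_wpM2l ?addr_ge0 ?mulr_ge0// lef_pV2 ?posrE//; lra.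
Qed.

Lemma laguerre_stochastically_complete : stochastically_complete alpha T.
Proof.
move=> t t0 n; apply/cvgrPdist_le => e e0.
have /cvgrPdist_le/(_ _ e0) H := cvg_sum_hkernel n (ltW t0).
near=> N; have : `|1 - \sum_(0 <= k < N) hkernel n k t| <= e by near: N.
rewrite sub0r normrN distrC.
suff -> : \sum_(0 <= m < N) tilde alpha T t (@delta R m) n * 1 - 1 =
    (\sum_(0 <= k < N) hkernel n k t - 1)%:C%C.
  by rewrite /cabs /= expr0n addr0 sqrtr_sqr normr_id.
rewrite rmorphB rmorph_sum rmorph1/=; congr (_ - 1); apply: eq_bigr => m _.
by rewrite mulr1 (tilde_delta halpha hT)// ltW.
Unshelve. all: by end_near. Qed.

End Completeness.

(** * Integrals over the half-line *)

Section Integrals.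
Variable R : realType.
Notation mu := (@lebesgue_measure R).

(** The integral of a nonnegative function is a supremum over the simple
    functions below it, hence monotone for arbitrary functions. *)
Lemma le_integral_subset (A B : set R) (f g : R -> \bar R) :
  (forall x, A x -> 0 <= f x)%E -> (forall x, B x -> 0 <= g x)%E ->
  (forall x, A x -> B x /\ (f x <= g x)%E) ->
  (\int[mu]_(x in A) f x <= \int[mu]_(x in B) g x)%E.
Proof.
move=> f0 g0 fg; rewrite !ge0_integralE//; apply: ereal_sup_le => _ [h hf <-].
exists h => // x; apply: le_trans (hf x) _; rewrite !patchE.
case: ifPn => [|_]; last by case: ifPn => // /set_mem; exact: g0.
by move=> /set_mem/fg[/mem_set -> ].
Qed.

Lemma is_derive_powR_1D (b x : R) : 0 < 1 + x ->
  is_derive x 1 (fun s => (1 + s) `^ b) (b * (1 + x) `^ (b - 1)).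
Proof.
move=> x1; have ds : is_derive x 1 (fun s : R => 1 + s) 1.
  by apply: is_derive_eq (is_deriveD (is_derive_cst (1 : R) x 1)
    (is_derive_id x 1)) _; rewrite add0r.
have := @is_derive1_comp R (@powR R ^~ b) (fun s : R => 1 + s) x _ _
  (is_derive1_powR b x1) ds.
by rewrite mulr1.
Qed.

Lemma cvg_powRN_y (b : R) : 0 < b -> (1 + x) `^ (- b) @[x --> +oo] --> (0 : R).
Proof.
move=> b0; apply/cvgrPdist_le => e e0; near=> x.
have ei0 : 0 < e^-1 by rewrite invr_gt0.
have x1 : 0 < 1 + x.
  by apply: ltr_wpDr => //; near: x; apply: nbhs_pinfty_ge; exact: num_real.
have : e^-1 `^ b^-1 <= 1 + x.
  rewrite -lerBlDl; near: x; apply: nbhs_pinfty_ge; exact: num_real.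
move=> H; rewrite sub0r normrN ger0_norm ?powR_ge0// powRN.
rewrite -[leRHS]invrK lef_pV2 ?posrE ?powR_gt0//.
have := ge0_ler_powR (ltW b0) _ _ H; rewrite !nnegrE powR_ge0 (ltW x1).
move=> /(_ isT isT); apply: le_trans.
by rewrite -powRrM mulVf ?gt_eqF// powRr1// ltW.
Unshelve. all: by end_near. Qed.

Lemma integral_powR_lty (b c : R) : 0 < b -> 0 <= c ->
  (\int[mu]_(x in `[0%R, +oo[) (c * (1 + x) `^ (- (1 + b)))%:E < +oo)%E.
Proof.
move=> b0 c0.
pose F x : R := - (c / b) * (1 + x) `^ (- b).
have dF (x : R) : 0 < 1 + x -> is_derive x 1 F (c * (1 + x) `^ (- (1 + b))).
  move=> x1; apply: is_derive_eq (is_deriveZ (- (c / b)) (is_derive_powR_1D (- b) x1)) _.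
  rewrite /GRing.scale/= (_ : - b - 1 = - (1 + b)); last by ring.
  by field; rewrite gt_eqF.
rewrite (@ge0_continuous_FTC2y R (fun x => c * (1 + x) `^ (- (1 + b))) F 0 0).
- exact: ltry.
- by move=> x x0; rewrite mulr_ge0 ?powR_ge0.
- apply: derivable_within_continuous => x; rewrite in_itv/= andbT => x0.
  have x1 : 0 < 1 + x by lra.
  apply: derivableM; first exact: derivable_cst.
  by have [] := is_derive_powR_1D (- (1 + b)) x1.
- rewrite -(mulr0 (- (c / b))); apply: cvgM; first exact: cvg_cst.
  exact: cvg_powRN_y.
- move=> x x0; have x1 : (0 : R) < 1 + x by lra.
  by have [] := dF x x1.
- apply: cvg_at_right_filter; apply: differentiable_continuous.
  have x1 : (0 : R) < 1 + 0 by lra.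
  have [d0 _] := dF 0 x1.
  exact/derivable1_diffP.
- move=> x; rewrite in_itv/= andbT => x0; rewrite derive1E.
  have x1 : (0 : R) < 1 + x by lra.
  by have [] := dF x x1.
Qed.

Lemma integral_inv (b : R) : 0 < b ->
  (\int[mu]_(x in `[0%R, b]) ((1 + x)^-1)%:E = (ln (1 + b))%:E)%E.
Proof.
move=> b0; pose F x : R := ln (1 + x).
have dF (x : R) : 0 < 1 + x -> is_derive x 1 F (1 + x)^-1.
  move=> x1; have ds : is_derive x 1 (fun s : R => 1 + s) 1.
    by apply: is_derive_eq (is_deriveD (is_derive_cst (1 : R) x 1)
      (is_derive_id x 1)) _; rewrite add0r.
  have := @is_derive1_comp _ (@ln R) (fun s : R => 1 + s) x _ _ (is_derive1_ln x1) ds.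
  by rewrite mulr1.
have cF (x : R) : 0 <= x -> F y @[y --> x] --> F x.
  move=> x0; apply: differentiable_continuous; apply/derivable1_diffP.
  have x1 : (0 : R) < 1 + x by lra.
  by have [] := dF x x1.
rewrite (@continuous_FTC2 R _ F 0 b b0).
- by rewrite /F addr0 ln1 sube0.
- apply: derivable_within_continuous => x; rewrite in_itv/= => /andP[x0 _].
  have x1 : 0 < 1 + x by lra.
  by apply: derivableV; [exact: lt0r_neq0|apply: derivableD].
- split.
  + move=> x; rewrite in_itv/= => /andP[x0 _].
    have x1 : (0 : R) < 1 + x by lra.
  by have [] := dF x x1.
  + by apply: cvg_at_right_filter; exact: cF.
  + by apply: cvg_at_left_filter; apply: cF; exact: ltW.
- move=> x; rewrite in_itv/= => /andP[x0 _]; rewrite derive1E.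
  have x1 : (0 : R) < 1 + x by lra.
  by have [] := dF x x1.
Qed.

End Integrals.

(** * Transience *)

Section Transience.
Variables (R : realType) (alpha : R).
Hypothesis halpha : -1 < alpha.
Variable T : R -> (nat -> R[i]) -> (nat -> R[i]).
Hypothesis hT : semigroup_exp_neg (laguerre_dom alpha) (tau alpha) T.
Local Notation sigma := (sigma alpha).
Local Notation hkernel := (hkernel alpha T).
Local Notation pow r := (r `^ (- (1 + alpha))).

Lemma hkernel_0n_gt0 n t : 0 < t -> 0 < hkernel 0 n t.
Proof.
move=> t0; rewrite (hkernel_0n halpha hT)// ?(ltW t0)//.
have t1 : 0 < 1 + t by lra.
rewrite mulr_gt0 ?exprn_gt0 ?sigma_gt0//.
rewrite /geom mulr_gt0 ?powR_gt0// exprn_gt0// subr_gt0 invf_lt1//; lra.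
Qed.

(** Passing through the state n at time 1 gives
    K_1(0, n) K_t(n, m) <= K_(1+t)(0, m), and row 0 is explicit. *)
Lemma hkernel_le n m t : 0 <= t ->
  hkernel n m t <= (hkernel 0 n 1)^-1 * pow (1 + t) * sigma m ^+ 2.
Proof.
move=> t0; have k0 := hkernel_0n_gt0 n ltr01.
have t1 : 0 <= 1 + t by lra.
rewrite -mulrA ler_pdivlMl//.
apply: le_trans (hkernel_mul_le halpha hT 0 n m ler01 t0) _.
rewrite (hkernel_0n halpha hT)// mulrC ler_wpM2r ?sqr_ge0//.
apply: (@le_trans _ _ (pow (1 + (1 + t)))); last by apply: le_pow => //; lra.
rewrite /geom ger_pMr ?powR_gt0//; last by lra.
have i1 : (1 + (1 + t))^-1 <= 1 by rewrite invf_le1//; lra.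
rewrite exprn_ile1 ?subr_ge0// gerBl invr_ge0; lra.
Qed.

Lemma tilde_nonnegE t (f : nat -> R) n : 0 <= t ->
  tilde_nonneg alpha T t f n =
  (\sum_(0 <= m <oo) (hkernel n m t * f m)%:E)%E.
Proof.
move=> t0; rewrite /tilde_nonneg; apply: eq_eseriesr => m _.
by rewrite (tilde_delta halpha hT).
Qed.

Lemma tilde_nonneg_ge0 t (f : nat -> R) n : 0 <= t -> (forall m, 0 <= f m) ->
  (0 <= tilde_nonneg alpha T t f n)%E.
Proof.
move=> t0 f0; rewrite tilde_nonnegE//; apply: nneseries_ge0 => m _ _.
by rewrite lee_fin mulr_ge0 ?(hkernel_ge0 halpha hT).
Qed.

(** By [hkernel_le] the semigroup applied to f is bounded by a multiple of
    (1 + t) ^ (- (1 + alpha)), with the l^1 norm of f as a factor. *)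
Lemma laguerre_transient : 0 < alpha -> transient alpha T.
Proof.
move=> a0 f f0 fS n; rewrite /ell1_sigma2/= in fS.
set S : \bar R := (\sum_(0 <= m <oo) _)%E in fS.
have S0 : (0 <= S)%E.
  by apply: nneseries_ge0 => m _ _; rewrite lee_fin mulr_ge0 ?sqr_ge0.
have Sfin : S \is a fin_num by rewrite ge0_fin_numE.
have k0 := hkernel_0n_gt0 n ltr01.
have c0 : 0 <= (hkernel 0 n 1)^-1 * fine S.
  by rewrite mulr_ge0 ?fine_ge0// invr_ge0 ltW.
apply: le_lt_trans (integral_powR_lty a0 c0).
apply: le_integral_subset => t /=; rewrite in_itv/= andbT => t0.
- exact: tilde_nonneg_ge0.
- by rewrite lee_fin mulr_ge0// powR_ge0.
split=> //.
rewrite tilde_nonnegE//.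
apply: (@le_trans _ _ (\sum_(0 <= m <oo)
   ((hkernel 0 n 1)^-1 * pow (1 + t))%:E * (`|f m| * sigma m ^+ 2)%:E)%E).
  apply: lee_nneseries => [m _ _|m _].
    by rewrite lee_fin mulr_ge0 ?(hkernel_ge0 halpha hT).
  rewrite -EFinM lee_fin ger0_norm// [f m * _]mulrC mulrA ler_wpM2r//.
  exact: hkernel_le.
rewrite nneseriesZl; last by move=> m _; rewrite lee_fin mulr_ge0 ?sqr_ge0.
by rewrite -/S -(fineK Sfin) -EFinM lee_fin mulrAC.
Qed.

(** With f = delta_0 the integrand at n = 0 is (1 + t) ^ (- (1 + alpha)), which
    dominates 1 / (1 + t) when alpha <= 0. *)
Lemma transient_gt0 : transient alpha T -> 0 < alpha.
Proof.
move=> tr; rewrite ltNge; apply/negP => a0.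
pose f (m : nat) : R := (m == 0)%:R.
have f0 m : 0 <= f m by rewrite ler0n.
have fS : ell1_sigma2 alpha f.
  rewrite /ell1_sigma2/= (nneseries_split 0 1); last first.
    by move=> k _; rewrite lee_fin mulr_ge0 ?sqr_ge0.
  rewrite eseries0 => [|k k1 _]; last by rewrite /f gtn_eqF ?normr0 ?mul0r.
  by rewrite big_nat1 adde0 ltry.
have /= := tr f f0 fS 0.
set I := (\int[_]_(_ in _) _)%E => Ilty.
have ln_le b : 0 < b -> ((ln (1 + b))%:E <= I)%E.
  move=> b0; rewrite -integral_inv//.
  apply: le_integral_subset => t /=; rewrite in_itv/=.
  - by move=> /andP[t0 _]; rewrite lee_fin invr_ge0; lra.
  - by rewrite andbT => t0; exact: tilde_nonneg_ge0.
  move=> /andP[t0 _]; split; first by rewrite /= in_itv/= t0.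
  have t1 : 1 <= 1 + t by lra.
  rewrite tilde_nonnegE//; apply: le_trans (nneseries_lim_ge 1 _); last first.
    by move=> m _ _; rewrite lee_fin mulr_ge0 ?(hkernel_ge0 halpha hT).
  rewrite big_nat1 lee_fin /f eqxx mulr1 (hkernel_n0 halpha hT)//.
  rewrite /geom expr0 mulr1 -powR_inv1; last by lra.
  by rewrite ler_powR//; lra.
have I0 : (0 <= I)%E by apply: le_trans (ln_le 1 ltr01); rewrite lee_fin ln_ge0//; lra.
have Ifin : I \is a fin_num by rewrite ge0_fin_numE.
have := ln_le (expR (fine I + 1)) (expR_gt0 _).
rewrite -(fineK Ifin) lee_fin; apply/negP; rewrite -ltNge.
apply: (@lt_le_trans _ _ (ln (expR (fine I + 1)))); first by rewrite expRK; lra.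
by have e0 := expR_gt0 (fine I + 1); rewrite ler_ln ?posrE//; lra.
Qed.

End Transience.

Theorem lemma4p8 (R : realType) (alpha : R) (halpha : -1 < alpha)
    (T : R -> (nat -> R[i]%C) -> (nat -> R[i]%C))
    (hT : semigroup_exp_neg (laguerre_dom alpha) (tau alpha) T) :
  (transient alpha T <-> 0 < alpha) /\ stochastically_complete alpha T.
Proof.
split; last exact: (laguerre_stochastically_complete halpha hT).
split; first exact: (transient_gt0 halpha hT).
exact: (laguerre_transient halpha hT).
Qed.
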